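(* Let $\sigma$ be an invertible ergodic measure-preserving transformation of a probability space $(\Omega,\mathbb P)$ and let $0<R<1$. Let $\mathsf{Blaschke}_R(\Omega)$ denote the set of measurable maps $\mathcal T\colon\omega\mapsto T_\omega$ from $\Omega$ to the collection of finite Blaschke products such that $r_{\mathcal T}(R)<R$, equipped with the distance $$d(\mathcal T,\mathcal S)=\operatorname{ess\,sup}_\omega\max_{z\in\overline{D_1}}|T_\omega(z)-S_\omega(z)|.$$ Call $\mathcal T\in\mathsf{Blaschke}_R(\Omega)$ stable if $\operatorname{ess\,inf}_\omega|T_\omega'(x_\omega)|>0$, where $x_\omega$ is the random fixed point of $\mathcal T$. Then the stable Blaschke product cocycles form an open dense subset of $\mathsf{Blaschke}_R(\Omega)$.
   Context: $D_\rho=\{|z|<\rho\}$. A finite Blaschke product is $T(z)=\zeta\prod_{j=1}^n\frac{z-\zeta_j}{1-\bar\zeta_jz}$ with $n\ge1$, $|\zeta|=1$, $|\zeta_j|<1$; a map $\omega\mapsto T_\omega$ is measurable if the parameters $n,\zeta,\zeta_1,\dots,\zeta_n$ are Borel measurable functions of $\omega$. $r_T(R)=\max_{|z|=R}|T(z)|$ and $r_{\mathcal T}(R)=\operatorname{ess\,sup}_\omega r_{T_\omega}(R)$. Random fixed point: if $r=r_{\mathcal T}(R)<R$, there is an a.e. unique measurable $x\colon\Omega\to\overline{D_r}$ with $T_\omega(x_\omega)=x_{\sigma\omega}$ a.e.; it is given by $x_\omega=\lim_{N\to\infty}T_{\sigma^{-1}\omega}\circ\cdots\circ T_{\sigma^{-N}\omega}(0)$.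 *)

(* Defs.v *)
From HB Require Import structures.
From mathcomp Require Import all_boot all_order all_algebra.
From mathcomp Require Import complex.
From mathcomp Require Import all_classical all_reals all_analysis ess_sup_inf.

Set Implicit Arguments.
Unset Strict Implicit.
Unset Printing Implicit Defensive.

Import Order.TTheory GRing.Theory Num.Theory.
Import numFieldNormedType.Exports.

Local Open Scope classical_set_scope.
Local Open Scope ring_scope.

(* R[i] seen as a numClosedFieldType: this is what gives access to the norm
   topology and to the (complex) derivative derive1. *)
Definition Cplx (R : realType) : numClosedFieldType := R[i].

(* The norm of R[i] takes its values in R[i]; this is the same number in R. *)
Definition cabs (R : realType) (z : Cplx R) : R := complex.Re `|z|.

(* Borel measurability of a C-valued function on a measurable set D. *)
Definition borel_fun (R : realType) (d : measure_display)
    (Omega : measurableType d) (D : set Omega) (f : Omega -> Cplx R) : Prop :=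
  measurable_fun D (f : Omega -> g_sigma_algebraType (@open (Cplx R))).

Section dynamics.
Context (R : realType) (d : measure_display) (Omega : measurableType d).
Variables (P : probability Omega R) (sigma : Omega -> Omega).

Definition measurably_invertible : Prop :=
  exists tau : Omega -> Omega,
    [/\ measurable_fun [set: Omega] sigma, measurable_fun [set: Omega] tau,
        cancel sigma tau & cancel tau sigma].

Definition measure_preserving : Prop :=
  measurable_fun [set: Omega] sigma /\
  forall A : set Omega, measurable A -> P (sigma @^-1` A) = P A.

Definition ergodic : Prop :=
  forall A : set Omega, measurable A -> sigma @^-1` A = A ->
    P A = 0%E \/ P A = 1%E.

End dynamics.

Section blaschke.
Context (R : realType).
Implicit Types (T S : Cplx R -> Cplx R) (rho : R).

(* Only the n first terms of the sequence a of zeros are used. *)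
Definition blaschke (n : nat) (zeta : Cplx R) (a : nat -> Cplx R)
    (z : Cplx R) : Cplx R :=
  zeta * \prod_(j < n) ((z - a j) / (1 - (a j)^* * z)).

(* A maximum of a continuous function over a compact set, hence written as a
   supremum; likewise in sup_dist. *)
Definition circle_max T rho : \bar R :=
  ereal_sup [set (cabs (T z))%:E | z in [set z : Cplx R | cabs z = rho]].

Definition sup_dist T S : \bar R :=
  ereal_sup [set (cabs (T z - S z))%:E | z in [set z : Cplx R | cabs z <= 1]].

End blaschke.

Section cocycles.
Context (R : realType) (d : measure_display) (Omega : measurableType d).
Variables (P : probability Omega R).
Implicit Types T S : Omega -> Cplx R -> Cplx R.

(* The j-th zero (j counted from 0) is a function defined on the measurable set
   where the degree exceeds j; its values elsewhere are irrelevant. *)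
Definition blaschke_cocycle T : Prop :=
  exists (n : Omega -> nat) (zeta : Omega -> Cplx R)
         (a : nat -> Omega -> Cplx R),
    [/\ measurable_fun [set: Omega] n,
        borel_fun [set: Omega] zeta,
        forall j, borel_fun [set w | (j < n w)%N] (a j),
        forall w, [/\ (1 <= n w)%N, cabs (zeta w) = 1 &
                      forall j, (j < n w)%N -> cabs (a j w) < 1] &
        forall w, T w = blaschke (n w) (zeta w) (a ^~ w)].

Definition cocycle_radius T (rho : R) : \bar R :=
  ess_sup P (fun w => circle_max (T w) rho).

Definition cocycle_dist T S : \bar R :=
  ess_sup P (fun w => sup_dist (T w) (S w)).

Record blaschkeSpace (rho : R) := BlaschkeSpace {
  cocycle :> Omega -> Cplx R -> Cplx R ;
  cocycle_blaschke : blaschke_cocycle cocycle ;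
  cocycle_radius_lt : (cocycle_radius cocycle rho < rho%:E)%E
}.

End cocycles.

Section topology_of_blaschkeSpace.
Context (R : realType) (d : measure_display) (Omega : measurableType d).
Variables (P : probability Omega R) (rho : R).
Local Notation X := (blaschkeSpace P rho).
Implicit Types T S U : X.

HB.instance Definition _ := gen_eqMixin X.
HB.instance Definition _ := gen_choiceMixin X.

Definition blaschke_ball T (e : R) : set X :=
  [set S : X | (cocycle_dist P T S < e%:E)%E].

Lemma cabs0 : cabs (0 : Cplx R) = 0.
Proof. by rewrite /cabs normr0. Qed.

Lemma cabsB (z w : Cplx R) : cabs (z - w) = cabs (w - z).
Proof. by rewrite /cabs distrC. Qed.

Lemma cabsD (z w : Cplx R) : cabs (z + w) <= cabs z + cabs w.
Proof.
by have := ler_normD z w; rewrite lecE raddfD => /andP[].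
Qed.

Lemma sup_dist_triangle (f g h : Cplx R -> Cplx R) :
  (sup_dist f h <= sup_dist f g + sup_dist g h)%E.
Proof.
apply: ge_ereal_sup => _ [z z1 <-].
apply: (@le_trans _ _ ((cabs (f z - g z))%:E + (cabs (g z - h z))%:E)%E).
  by rewrite -EFinD lee_fin (le_trans _ (cabsD _ _))// addrA subrK.
by apply: leeD; apply: ereal_sup_ubound; exists z.
Qed.

Lemma blaschke_ball_center T (e : R) : 0 < e -> blaschke_ball T e T.
Proof.
move=> e0; rewrite /blaschke_ball/= (@le_lt_trans _ _ 0%E)//.
apply/ess_supP; apply: nearW => w; apply: ge_ereal_sup => _ [z _ <-].
by rewrite subrr cabs0.
Qed.

Lemma blaschke_ball_sym T S (e : R) : blaschke_ball T e S -> blaschke_ball S e T.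
Proof.
rewrite /blaschke_ball/=; apply: le_lt_trans; apply: le_ess_sup.
apply: nearW => w; apply: ge_ereal_sup => _ [z z1 <-].
by apply: ereal_sup_ubound; exists z => //; rewrite cabsB.
Qed.

Lemma blaschke_ball_triangle T S U (e1 e2 : R) :
  blaschke_ball T e1 S -> blaschke_ball S e2 U -> blaschke_ball T (e1 + e2) U.
Proof.
rewrite /blaschke_ball/= => TS SU; rewrite EFinD.
apply: le_lt_trans (lteD TS SU); apply: le_trans (ess_supD _ _ _).
by apply: le_ess_sup; apply: nearW => w; exact: sup_dist_triangle.
Qed.

Let ent : set_system (X * X) := entourage_ blaschke_ball.

(* cocycle_dist is only a pseudometric on blaschkeSpace, since cocycles are not
   identified when they agree almost everywhere. *)
HB.instance Definition _ := hasNbhs.Build X (nbhs_ ent).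
HB.instance Definition _ := @Nbhs_isPseudoMetric.Build R X ent erefl
  blaschke_ball blaschke_ball_center blaschke_ball_sym blaschke_ball_triangle
  erefl.

End topology_of_blaschkeSpace.

Section stability.
Context (R : realType) (d : measure_display) (Omega : measurableType d).
Variables (P : probability Omega R) (sigma : Omega -> Omega) (rho : R).

Definition random_fixed_point (T : Omega -> Cplx R -> Cplx R)
    (x : Omega -> Cplx R) : Prop :=
  [/\ borel_fun [set: Omega] x,
      forall w, ((cabs (x w))%:E <= cocycle_radius P T rho)%E &
      {ae P, forall w, T w (x w) = x (sigma w)}].

(* A random fixed point exists and is a.e. unique, so that its choice below is
   immaterial. *)
Definition stable : set (blaschkeSpace P rho) :=
  [set T | exists x : Omega -> Cplx R, random_fixed_point T x /\
     (0 < ess_inf P (fun w => (cabs (derive1 (T w) (x w)))%:E))%E].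

End stability.

(* Main.v *)
(* If |T_w| <= r < rho on |z| = rho, then by the Schwarz-Pick lemma T_w contracts
   the pseudo-hyperbolic distance of the disc of radius rho by a uniform factor,
   so an approximate random fixed point (error eta) has a genuine one within
   O(eta). Openness follows from Cauchy estimates. For density, a Blaschke product
   f with f(x) = x' is conjugated by disc automorphisms into z B(z), and moving
   B(0) away from 0 by another automorphism bounds the derivative at x from below
   without changing f(x). This is applied to one representative on each fiber of a
   countable measurable partition on which T and its fixed point x are almost
   constant; x is then an approximate fixed point of the new cocycle.

   All functions involved are rational, so the complex analysis reduces to a
   maximum principle for rational functions without poles in the disc. *)
Require Import Defs.
From mathcomp Require Import all_boot all_order all_algebra.
From mathcomp Require Import cyclic separable cyclotomic complex ring lra.
From mathcomp Require Import all_classical all_reals all_analysis ess_sup_inf.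

Set Implicit Arguments.
Unset Strict Implicit.
Unset Printing Implicit Defensive.

Import Order.TTheory GRing.Theory Num.Theory.
Import numFieldNormedType.Exports.

Local Open Scope classical_set_scope.
Local Open Scope ring_scope.

(** Stability is read at the fixed point, which depends on the cocycle along the whole past of an
    orbit and moves with it. A general perturbation of size [eps] displaces it by a multiple of
    [eps], while the derivative gained is only [dl], a small fraction of [eps], so the gain could be
    lost again. Keeping the value at the fixed point exactly is what avoids this: the error [eta]
    left in the fixed point equation comes from the partition alone and is chosen after [dl], so
    small that the derivative at the true fixed point is still at least [dl / 4]. The degree and the
    zeros of $T_\omega$ are not uniformly controlled in $\omega$, but all constants must be. The
    bounds on derivatives, contraction and perturbation therefore rest only on $|f|\le1$ on the unit
    disc and on the margins $r<\rho<1$. Measurability is used in the form of approximate constancy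
    on the cells of countable partitions, which survives evaluation, composition with $\sigma^{-1}$
    and uniform limits. *)

Section complex_modulus.
Context (R : realType).
Local Notation C := (Cplx R).
Implicit Types (z w : C).

Lemma cabsE z : (cabs z)%:C%C = `|z|.
Proof. by rewrite /cabs RRe_real // normr_real. Qed.

Lemma cabs_ge0 z : 0 <= cabs z.
Proof. by rewrite -lecR cabsE rmorph0 normr_ge0. Qed.

Lemma cabsM z w : cabs (z * w) = cabs z * cabs w.
Proof. by apply: (@complexI R); rewrite rmorphM /= !cabsE normrM. Qed.

Lemma cabsV z : cabs z^-1 = (cabs z)^-1.
Proof. by apply: (@complexI R); rewrite fmorphV /= !cabsE normfV. Qed.

Lemma cabs_div z w : cabs (z / w) = cabs z / cabs w.
Proof. by rewrite cabsM cabsV. Qed.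

Lemma cabsN z : cabs (- z) = cabs z.
Proof. by rewrite /cabs normrN. Qed.

Lemma cabs1 : cabs (1 : C) = 1.
Proof. by rewrite /cabs normr1. Qed.

Lemma cabsX z n : cabs (z ^+ n) = cabs z ^+ n.
Proof. by elim: n => [|n IH]; rewrite ?expr0 ?cabs1 // !exprS cabsM IH. Qed.

Lemma cabs_prod I (r : seq I) (P : pred I) (F : I -> C) :
  cabs (\prod_(i <- r | P i) F i) = \prod_(i <- r | P i) cabs (F i).
Proof. exact: (big_morph _ cabsM cabs1). Qed.

Lemma cabs_sum I (r : seq I) (P : pred I) (F : I -> C) :
  cabs (\sum_(i <- r | P i) F i) <= \sum_(i <- r | P i) cabs (F i).
Proof.
elim/big_rec2: _ => [|i x y _ h]; first by rewrite cabs0.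
by apply: le_trans (cabsD _ _) _; rewrite lerD2l.
Qed.

Lemma cabs_eq0 z : (cabs z == 0) = (z == 0).
Proof. by rewrite -(inj_eq (@complexI R)) cabsE rmorph0 normr_eq0. Qed.

Lemma cabs_gt0 z : (0 < cabs z) = (z != 0).
Proof. by rewrite lt_neqAle cabs_ge0 andbT eq_sym cabs_eq0. Qed.

Lemma cabs_conj z : cabs z^* = cabs z.
Proof. by rewrite /cabs norm_conjC. Qed.

Lemma cabsR (x : R) : cabs (x%:C%C : C) = `|x|.
Proof.
by apply: (@complexI R); rewrite cabsE normc_def /= expr0n addr0 sqrtr_sqr.
Qed.

Lemma cabs_nat n : cabs (n%:R : C) = n%:R.
Proof.
have -> : (n%:R : C) = (n%:R : R)%:C%C by rewrite rmorph_nat.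
by rewrite cabsR normr_nat.
Qed.

Lemma cabs_sqr z : ((cabs z) ^+ 2)%:C%C = z * z^*.
Proof. by rewrite rmorphXn /= cabsE normCK. Qed.

Lemma cabs_sqrE z : (cabs z) ^+ 2 = complex.Re z ^+ 2 + complex.Im z ^+ 2.
Proof. by apply: (@complexI R); rewrite add_Re2_Im2 rmorphXn /= cabsE. Qed.

Lemma cabs_Re z : `|complex.Re z| <= cabs z.
Proof. by rewrite -lecR cabsE normc_ge_Re. Qed.

Lemma cabs_Im z : `|complex.Im z| <= cabs z.
Proof.
rewrite -ler_sqr ?nnegrE ?cabs_ge0 // cabs_sqrE real_normK ?num_real //.
by rewrite lerDr sqr_ge0.
Qed.

Lemma cabs_le_ReIm z : cabs z <= `|complex.Re z| + `|complex.Im z|.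
Proof.
rewrite -ler_sqr ?nnegrE ?cabs_ge0 ?addr_ge0 // cabs_sqrE sqrrD.
rewrite !real_normK ?num_real // addrAC lerDl mulrn_wge0 //.
Qed.

Lemma cabsB_ge z w : cabs z - cabs w <= cabs (z - w).
Proof. by rewrite lerBlDr -{1}(subrK w z) cabsD. Qed.

Lemma cabsD_ge z w : cabs z - cabs w <= cabs (z + w).
Proof. by rewrite -{2}(opprK w) -(cabsN w) cabsB_ge. Qed.

Lemma cabsB_le z w : cabs (z - w) <= cabs z + cabs w.
Proof. by rewrite -(cabsN w) cabsD. Qed.

Lemma cabs_dist_triangle (z w u : C) : cabs (z - u) <= cabs (z - w) + cabs (w - u).
Proof. by rewrite -{1}(subrK w z) -addrA cabsD. Qed.

Lemma subr1_conjM_neq0 z w : cabs z < 1 -> cabs w <= 1 -> 1 - z^* * w != 0.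
Proof.
move=> z1 w1; rewrite -cabs_gt0; apply: lt_le_trans (cabsB_ge _ _).
rewrite cabs1 cabsM cabs_conj subr_gt0.
by apply: le_lt_trans z1; rewrite ler_piMr ?cabs_ge0.
Qed.

Lemma cabs_subr1_conjM_ge z w :
  cabs z <= 1 -> cabs w <= 1 -> 1 - cabs z <= cabs (1 - z^* * w).
Proof.
move=> z1 w1; apply: le_trans (cabsB_ge _ _).
by rewrite cabs1 cabsM cabs_conj lerD2l lerN2 ler_piMr ?cabs_ge0.
Qed.

Lemma cabs_blaschke_factor z w :
  cabs (1 - z^* * w) ^+ 2 - cabs (w - z) ^+ 2 =
  (1 - cabs z ^+ 2) * (1 - cabs w ^+ 2).
Proof.
apply: (@complexI R); rewrite rmorphB [RHS]rmorphM /= ![in RHS]rmorphB /= !rmorph1 !cabs_sqr.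
by rewrite !(rmorphB, rmorphM, rmorph1) /= conjCK; ring.
Qed.

Lemma cabs_blaschke_factor_le z w :
  cabs z <= 1 -> cabs w <= 1 -> cabs (w - z) <= cabs (1 - z^* * w).
Proof.
move=> z1 w1; rewrite -ler_sqr ?nnegrE ?cabs_ge0 // -subr_ge0.
by rewrite cabs_blaschke_factor mulr_ge0 // subr_ge0 expr_le1 // cabs_ge0.
Qed.

Lemma cabs_blaschke_factor_ge z w :
  cabs z <= 1 -> 1 <= cabs w -> cabs (1 - z^* * w) <= cabs (w - z).
Proof.
move=> z1 w1; rewrite -ler_sqr ?nnegrE ?cabs_ge0 // -subr_le0.
rewrite cabs_blaschke_factor mulr_ge0_le0 // ?subr_ge0 ?subr_le0.
  by rewrite expr_le1 // cabs_ge0.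
by rewrite expr_ge1 // cabs_ge0.
Qed.

Lemma circle_point (rho : R) : 0 <= rho -> cabs (rho%:C%C : C) = rho.
Proof. by move=> h; rewrite cabsR ger0_norm. Qed.

End complex_modulus.

(** * Maximum principle for polynomials and for quotients of polynomials *)

Section maximum_principle.
Context (R : realType).
Local Notation C := (Cplx R).
Implicit Types (p P D : {poly C}) (z w : C) (rho M : R).

Lemma primitive_root_exists n : (0 < n)%N -> exists w : C, n.-primitive_root w.
Proof.
move=> n0; pose p : {poly C} := 'X^n - 1.
have [r Dp] := closed_field_poly_normal p.
rewrite (monicP _) ?monicXnsubC // scale1r in Dp.
have rn1 : all n.-unity_root r by apply/allP => z; rewrite -root_prod_XsubC -Dp.
have sz_r : (n < (size r).+1)%N.
  by rewrite -(size_prod_XsubC r id) -Dp size_XnsubC.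
have [|z] := hasP (has_prim_root n0 rn1 _ sz_r); last by exists z.
by rewrite -separable_prod_XsubC -Dp separable_Xn_sub_1 // pnatr_eq0 -lt0n.
Qed.

(** Discrete mean value property: after the affine substitution the coefficient of degree i is
    multiplied by $\sum_k (w^i)^k$, a geometric sum that vanishes for $0<i<n$. Only the constant
    term survives. *)
Lemma poly_mean p n w z s : (0 < n)%N -> (size p <= n)%N -> n.-primitive_root w ->
  \sum_(k < n) p.[z + s * w ^+ k] = n%:R * p.[z].
Proof.
move=> n0 szp wn; pose q := p \Po (z%:P + s *: 'X).
have qE x : q.[x] = p.[z + s * x] by rewrite horner_comp !hornerE.
have szq : (size q <= n)%N.
  have [p0|p0] := eqVneq p 0; first by rewrite /q p0 comp_poly0 size_poly0.
  apply: leq_trans szp.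
  have szl : (size (z%:P + s *: 'X)%R <= 2)%N.
    rewrite (leq_trans (size_polyD _ _)) // geq_max.
    rewrite (leq_trans (size_polyC_leq1 _)) //=.
    by rewrite (leq_trans (size_scale_leq _ _)) // size_polyX.
  rewrite (leq_trans (size_comp_poly_leq _ _)) //.
  rewrite -(ltn_predK (_ : 0 < size p)%N) ?size_poly_gt0 // ltnS.
  have : ((size (z%:P + s *: 'X)%R).-1 <= 1)%N by case: size szl => // -[|[]].
  by move=> h; rewrite -{2}[(size p).-1]muln1 leq_mul2l h orbT.
under eq_bigr do rewrite -qE (horner_coef_wide _ szq).
rewrite exchange_big /= (bigD1 (Ordinal n0)) //= [X in _ + X]big1 ?addr0; last first.
  move=> i i0 /=.
under eq_bigr do rewrite -exprM mulnC exprM.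
  rewrite -mulr_sumr; apply/eqP; rewrite mulf_eq0; apply/orP; right.
  have wi : w ^+ i - 1 != 0.
    rewrite subr_eq0 -(prim_order_dvd wn) gtnNdvd //.
    by rewrite lt0n; apply: contra i0 => /eqP h; apply/eqP/val_inj.
  rewrite -(mulrI_eq0 _ (mulfI wi)) -subrX1 -exprM mulnC exprM.
  by rewrite (prim_expr_order wn) expr1n subrr.
under eq_bigr do rewrite expr0 mulr1.
rewrite sumr_const card_ord mulr_natl; congr (_ *+ _).
by have := qE 0; rewrite horner_coef0 mulr0 addr0.
Qed.

Lemma cabs_poly_le p rho z : cabs z <= rho ->
  cabs p.[z] <= \sum_(i < size p) cabs p`_i * rho ^+ i.
Proof.
move=> zr; rewrite horner_coef; apply: le_trans (cabs_sum _ _ _) _.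
apply: ler_sum => i _; rewrite cabsM cabsX ler_wpM2l ?cabs_ge0 //.
by rewrite lerXn2r ?nnegrE ?cabs_ge0 // (le_trans (cabs_ge0 z)).
Qed.

Lemma cabs_direction z : exists u : C, cabs u = 1 /\ z = (cabs z)%:C%C * u.
Proof.
have [->|z0] := eqVneq z 0.
  by exists 1; rewrite cabs1 cabs0 rmorph0 mul0r.
have z0' : (cabs z)%:C%C != 0 :> C by rewrite fmorph_eq0 cabs_eq0.
exists (z / (cabs z)%:C%C); split; last by rewrite mulrC divfK.
by rewrite cabs_div cabsR ger0_norm ?cabs_ge0 // divff // cabs_eq0.
Qed.

(* The sup S over the disc is compared with M by averaging over the vertices of
   a regular polygon inscribed in the circle centered at a near-maximum and
   internally tangent to |z| = rho: one vertex lies on |z| = rho. *)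
Lemma poly_maximum_principle p rho M : 0 < rho ->
  (forall z, cabs z = rho -> cabs p.[z] <= M) ->
  forall z, cabs z <= rho -> cabs p.[z] <= M.
Proof.
move=> rho0 pM z0 z0rho.
pose A := [set cabs p.[z] | z in [set z : C | cabs z <= rho]].
have Asup : has_sup A.
  split; first by exists (cabs p.[z0]); exists z0.
  by exists (\sum_(i < size p) cabs p`_i * rho ^+ i) => _ [z /= zr <-];
    exact: cabs_poly_le.
have AS z : cabs z <= rho -> cabs p.[z] <= sup A.
  by move=> zr; apply: ub_le_sup; [exact: (proj2 Asup)|exists z].
apply: le_trans (AS _ z0rho) _; rewrite leNgt; apply/negP => MS.
pose n := (size p).+1.
have n0 : (0 < n%:R :> R) by rewrite ltr0n.
(* One vertex with value at most M among n, the others being at most [sup A], lowers the average by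
   this amount; a center closer than that to the supremum gives the contradiction. *)
have e0 : 0 < (sup A - M) / n%:R by rewrite divr_gt0 // subr_gt0.
have [_ [z /= zr <-] zS] := sup_adherent e0 Asup.
have [w wn] := @primitive_root_exists n isT.
have [u [u1 zu]] := cabs_direction z.
pose s := (rho - cabs z)%:C%C * u : C.
have cs : cabs s = rho - cabs z.
  by rewrite /s cabsM u1 mulr1 cabsR ger0_norm // subr_ge0.
have w1 : cabs w = 1.
  apply/eqP; rewrite -(@pexpr_eq1 _ _ n) ?cabs_ge0 // -cabsX.
  by rewrite (prim_expr_order wn) cabs1.
have zsr (k : 'I_n) : cabs (z + s * w ^+ k) <= rho.
  apply: le_trans (cabsD _ _) _.
  by rewrite cabsM cabsX w1 expr1n mulr1 cs subrKC.
have zs : cabs (z + s * w ^+ 0) = rho.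
  rewrite expr0 mulr1 {1}zu /s -mulrDl -rmorphD /= subrKC cabsM u1 mulr1.
  by rewrite circle_point // ltW.
have := congr1 (@cabs R) (@poly_mean p n w z s isT (leqnSn _) wn).
rewrite cabsM cabs_nat.
rewrite big_ord_recl => e.
have : n%:R * cabs p.[z] <= M + (size p)%:R * sup A.
  rewrite -e; apply: le_trans (cabsD _ _) _; apply: lerD.
    by apply: pM; rewrite zs.
  apply: le_trans (cabs_sum _ _ _) _.
  apply: le_trans (_ : \sum_(i < size p) sup A <= _).
    by apply: ler_sum => i _; apply: AS; exact: zsr.
  by rewrite sumr_const card_ord mulr_natl.
apply/negP; rewrite -ltNge.
have : n%:R * (sup A - (sup A - M) / n%:R) < n%:R * cabs p.[z].
  by rewrite ltr_pM2l.
apply: le_lt_trans; rewrite mulrBr mulrCA divff ?mulr1 ?gt_eqF //.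
by rewrite /n -natr1; lra.
Qed.

Lemma le_of_geometric (a b q : R) : 0 <= q < 1 ->
  (forall k : nat, a * (1 - q ^+ k) <= b * (1 + q ^+ k)) -> a <= b.
Proof.
move=> /andP[q0 q1] h.
have qk : (fun k => q ^+ k) @ \oo --> (0 : R).
  by apply: cvg_expr; rewrite ger0_norm.
have l1 : (fun k => a * (1 - q ^+ k)) @ \oo --> a * (1 - 0).
  by apply: cvgMr; apply: cvgB => //; exact: cvg_cst.
have l2 : (fun k => b * (1 + q ^+ k)) @ \oo --> b * (1 + 0).
  by apply: cvgMr; apply: cvgD => //; exact: cvg_cst.
by have := ler_cvg_to l1 l2 (nearW _ h); rewrite subr0 addr0 !mulr1; apply.
Qed.

(* Each factor z - d of the denominator is replaced by z^K - d^K, which is a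
   polynomial multiple of it and has almost constant modulus for large K. *)
Lemma prod_maximum_principle (ds : seq C) p rho M : 0 < rho ->
  (forall d, d \in ds -> rho < cabs d) ->
  (forall z, cabs z = rho -> cabs p.[z] <= M * \prod_(d <- ds) cabs (z - d)) ->
  forall z, cabs z <= rho -> cabs p.[z] <= M * \prod_(d <- ds) cabs (z - d).
Proof.
move=> rho0; elim: ds p M => [|d ds IH] p M dsr pM z0 z0r.
  rewrite big_nil mulr1; apply: poly_maximum_principle z0 z0r => // z zr.
  by have := pM z zr; rewrite big_nil mulr1.
have dr : rho < cabs d by apply: dsr; rewrite mem_head.
have d0 : 0 < cabs d by exact: lt_trans dr.
pose B := \prod_(d <- ds) cabs (z0 - d).
(* The induction hypothesis is applied to p times $(z^k-d^k)/(z-d)$, a polynomial, with one root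
   fewer in the denominator. *)
have key (k : nat) : cabs p.[z0] * cabs (z0 ^+ k - d ^+ k) <=
    M * (rho ^+ k + cabs d ^+ k) * B * cabs (z0 - d).
  pose q : {poly C} := \sum_(i < k) d ^+ i *: 'X^(k.-1 - i).
  have qE z : z ^+ k - d ^+ k = (z - d) * q.[z].
    rewrite subrXX /q horner_sum; congr (_ * _); apply: eq_bigr => i _.
    by rewrite hornerZ hornerXn mulrC.
  rewrite qE cabsM mulrCA mulrC ler_wpM2r ?cabs_ge0 // -cabsM -hornerM.
  apply: (IH (p * q) (M * (rho ^+ k + cabs d ^+ k))) => //.
    by move=> e eds; apply: dsr; rewrite inE eds orbT.
  move=> z zr; rewrite hornerM cabsM.
  have zd : 0 < cabs (z - d).
    rewrite cabs_gt0 subr_eq0; apply/eqP => zd.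
    by move: dr; rewrite -zd zr ltxx.
  rewrite -(ler_pM2r zd).
  rewrite [leLHS](_ : _ = cabs p.[z] * cabs (z ^+ k - d ^+ k)); last first.
    by rewrite qE cabsM; ring.
  have := pM z zr; rewrite big_cons => pMz.
  apply: le_trans (ler_wpM2r (cabs_ge0 _) pMz) _.
  set b := \prod_(j <- ds) _; rewrite [leRHS](_ : _ =
    M * (cabs (z - d) * b) * (rho ^+ k + cabs d ^+ k)); last by ring.
  apply: ler_wpM2l; first exact: le_trans (cabs_ge0 _) pMz.
  by apply: le_trans (cabsB_le _ _) _; rewrite !cabsX zr.
rewrite big_cons -/B.
(* After division by $|d|^k$ the error factors are $1\pm(\rho/|d|)^k$, and k tends to infinity. *)
apply: (@le_of_geometric _ _ (rho / cabs d)).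
  by rewrite divr_ge0 ?cabs_ge0 ?(ltW rho0) //= ltr_pdivrMr ?mul1r.
move=> k.
have dk : 0 < cabs d ^+ k by rewrite exprn_gt0.
rewrite -(ler_pM2r dk) -!mulrA !mulrDl mulNr !mul1r -exprMn.
rewrite divfK ?gt_eqF //.
apply: le_trans (_ : _ <= cabs p.[z0] * cabs (z0 ^+ k - d ^+ k)) _.
  apply: ler_wpM2l; first exact: cabs_ge0.
  rewrite cabsB; apply: le_trans (cabsB_ge _ _); rewrite !cabsX lerD2l lerN2.
  by rewrite lerXn2r ?nnegrE ?cabs_ge0 ?(ltW rho0).
by apply: le_trans (key k) _; rewrite le_eqVlt; apply/orP; left; apply/eqP; ring.
Qed.

End maximum_principle.

(** * Rational functions without poles in a disc: difference quotients and Cauchy estimates *)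

Section rational_functions.
Context (R : realType).
Local Notation C := (Cplx R).
Implicit Types (P D : {poly C}) (f g q : C -> C) (z w x : C) (rho s M : R).

(** Stand-in for holomorphy near the closed disc. The class is closed under ring operations,
    inverses of nonvanishing functions and difference quotients; the latter take the place of power
    series. *)
Definition rat_on rho f := exists P D,
  (forall z, cabs z <= rho -> D.[z] != 0) /\
  (forall z, cabs z <= rho -> f z = P.[z] / D.[z]).

Lemma rat_on_cst rho c : rat_on rho (fun=> c).
Proof.
by exists c%:P, 1; split=> z _; rewrite !hornerE ?oner_neq0 // invr1 mulr1.
Qed.

Lemma rat_on_id rho : rat_on rho id.
Proof.
by exists 'X, 1; split=> z _; rewrite !hornerE ?oner_neq0 // invr1 mulr1.
Qed.

Lemma rat_onD rho f g : rat_on rho f -> rat_on rho g ->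
  rat_on rho (fun z => f z + g z).
Proof.
move=> [P [D [D0 fE]]] [P' [D' [D0' gE]]].
exists (P * D' + P' * D), (D * D'); split=> z zr.
  by rewrite hornerM mulf_neq0 ?D0 ?D0'.
rewrite fE // gE // !hornerE; field.
by rewrite D0 // D0'.
Qed.

Lemma rat_onM rho f g : rat_on rho f -> rat_on rho g ->
  rat_on rho (fun z => f z * g z).
Proof.
move=> [P [D [D0 fE]]] [P' [D' [D0' gE]]].
exists (P * P'), (D * D'); split=> z zr.
  by rewrite hornerM mulf_neq0 ?D0 ?D0'.
by rewrite fE // gE // !hornerM mulf_div.
Qed.

Lemma rat_onB rho f g : rat_on rho f -> rat_on rho g ->
  rat_on rho (fun z => f z - g z).
Proof.
move=> rf rg; have := rat_onD rf (rat_onM (rat_on_cst rho (-1)) rg).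
by congr rat_on; apply/funext => z; rewrite mulN1r.
Qed.

Lemma rat_onV rho f : rat_on rho f -> (forall z, cabs z <= rho -> f z != 0) ->
  rat_on rho (fun z => (f z)^-1).
Proof.
move=> [P [D [D0 fE]]] f0; exists D, P; split=> z zr; last first.
  by rewrite fE // invf_div.
by have := f0 z zr; rewrite fE // mulf_eq0 => /norP[].
Qed.

Lemma rat_on_prod rho (I : Type) (r : seq I) (F : I -> C -> C) :
  (forall i, rat_on rho (F i)) -> rat_on rho (fun z => \prod_(i <- r) F i z).
Proof.
move=> rF; elim: r => [|i r IH].
  have := rat_on_cst rho 1; congr rat_on.
  by apply/funext => z; rewrite big_nil.
have := rat_onM (rF i) IH; congr rat_on.
by apply/funext => z; rewrite big_cons.
Qed.

Lemma rat_on_le rho rho' f : rho' <= rho -> rat_on rho f -> rat_on rho' f.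
Proof.
move=> rr [P [D [D0 fE]]]; exists P, D.
by split=> z zr; [apply: D0|apply: fE]; apply: le_trans rr.
Qed.

Lemma root_factorization_on rho D : 0 < rho ->
  (forall z, cabs z <= rho -> D.[z] != 0) ->
  exists ds : seq C, [/\ forall d, d \in ds -> rho < cabs d, lead_coef D != 0 &
    forall z, cabs D.[z] = cabs (lead_coef D) * \prod_(d <- ds) cabs (z - d)].
Proof.
move=> rho0 D0; have [ds Dds] := closed_field_poly_normal D; exists ds.
have DE z : cabs D.[z] = cabs (lead_coef D) * \prod_(d <- ds) cabs (z - d).
  rewrite {1}Dds hornerZ cabsM horner_prod cabs_prod; congr (_ * _).
  by apply: eq_bigr => d _; rewrite !hornerE.
split=> // [d dds|].
  rewrite ltNge; apply/negP => /D0; rewrite -cabs_eq0 DE (big_rem d) //=.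
  by rewrite subrr cabs0 mul0r mulr0 eqxx.
rewrite lead_coef_eq0; apply/eqP => D00.
have : cabs (0 : C) <= rho by rewrite cabs0 ltW.
by move=> /D0; rewrite D00 horner0 eqxx.
Qed.

Lemma rat_maximum_principle rho f M : 0 < rho -> rat_on rho f ->
  (forall z, cabs z = rho -> cabs (f z) <= M) ->
  forall z, cabs z <= rho -> cabs (f z) <= M.
Proof.
move=> rho0 [P [D [D0 fE]]] fM.
have [ds [dsr l0 DE]] := root_factorization_on rho0 D0.
have PM z : cabs z <= rho -> (cabs (f z) <= M) =
    (cabs P.[z] <= M * cabs (lead_coef D) * \prod_(d <- ds) cabs (z - d)).
  by move=> zr; rewrite fE // cabs_div ler_pdivrMr ?cabs_gt0 ?D0 // DE mulrA.
move=> z zr; rewrite PM //; apply: prod_maximum_principle zr => // y yr.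
by rewrite -PM ?yr // fM.
Qed.

Lemma rat_on_bounded rho f : 0 < rho -> rat_on rho f ->
  exists M, forall z, cabs z <= rho -> cabs (f z) <= M.
Proof.
move=> rho0 [P [D [D0 fE]]].
have [ds [dsr l0 DE]] := root_factorization_on rho0 D0.
pose A := \sum_(i < size P) cabs P`_i * rho ^+ i.
pose B := cabs (lead_coef D) * \prod_(d <- ds) (cabs d - rho).
have B0 : 0 < B.
  rewrite mulr_gt0 ?cabs_gt0 // big_seq; apply: prodr_gt0 => d dds.
  by rewrite subr_gt0 dsr.
have DB z : cabs z <= rho -> B <= cabs D.[z].
  move=> zr; rewrite DE ler_wpM2l ?cabs_ge0 // big_seq [leRHS]big_seq.
  apply: ler_prod => d dds; rewrite subr_ge0 ltW ?dsr //= cabsB.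
  by apply: le_trans (cabsB_ge _ _); rewrite lerD2l lerN2.
exists (A / B) => z zr; rewrite fE // cabs_div ler_pM ?cabs_ge0 ?invr_ge0 ?cabs_ge0 //.
  exact: cabs_poly_le.
by rewrite lef_pV2 ?posrE ?DB // (lt_le_trans B0) // DB.
Qed.

(** The numerator $P(z)D(x)-P(x)D(z)$ of the difference vanishes at x, so $z-x$ divides it as a
    polynomial. *)
Lemma rat_on_slope rho f x : cabs x <= rho -> rat_on rho f ->
  exists q, rat_on rho q /\
    forall z, cabs z <= rho -> f z - f x = (z - x) * q z.
Proof.
move=> xr [P [D [D0 fE]]].
pose N := P * (D.[x])%:P - (P.[x])%:P * D.
have /factor_theorem[K NK] : root N x.
  by apply/rootP; rewrite !hornerE subrr.
exists (fun z => K.[z] / (D * (D.[x])%:P).[z]); split.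
  exists K, (D * (D.[x])%:P); split=> // z zr.
  by rewrite !hornerE mulf_neq0 ?D0.
move=> z zr; rewrite !fE // mulrA [(z - x) * _]mulrC.
have -> : K.[z] * (z - x) = N.[z] by rewrite NK !hornerE.
rewrite !hornerE; field.
by rewrite D0 // D0.
Qed.

(** Cauchy estimate by the maximum principle: on $|z|=\rho$ one has $|z-x|\ge\rho-s$ and
    $|f(z)-f(x)|\le2M$, and the bound on the quotient passes inside, the point x included. *)
Lemma slope_bound rho s f q x M : 0 < rho -> s < rho -> cabs x <= s ->
  rat_on rho q -> (forall z, cabs z <= rho -> f z - f x = (z - x) * q z) ->
  (forall z, cabs z <= rho -> cabs (f z) <= M) ->
  forall z, cabs z <= rho -> cabs (q z) <= 2 * M / (rho - s).
Proof.
move=> rho0 sr xs rq fq fM; apply: rat_maximum_principle => // z zr.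
have zx : rho - s <= cabs (z - x).
  by apply: le_trans (cabsB_ge _ _); rewrite zr lerD2l lerN2.
have rs : 0 < rho - s by rewrite subr_gt0.
rewrite ler_pdivlMr // mulrC.
apply: le_trans (ler_wpM2r (cabs_ge0 _) zx) _; rewrite -cabsM -fq ?zr //.
apply: le_trans (cabsB_le _ _) _; rewrite mulrDl mul1r.
by rewrite lerD ?fM ?zr // (le_trans xs) // ltW.
Qed.

Lemma derive1_of_quadratic f x (a : C) (K e : R) : 0 < e ->
  (forall z, cabs (z - x) <= e ->
     cabs (f z - f x - (z - x) * a) <= K * cabs (z - x) ^+ 2) ->
  derive1 f x = a.
Proof.
move=> e0 fa; rewrite /derive1; apply: cvg_lim; first exact: norm_hausdorff.
apply/cvgrPdist_le => eps eps0.
(* Radii of the norm topology are elements of R[i]; a positive one is real. *)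
have epsE : eps = (complex.Re eps)%:C%C by rewrite RRe_real // gtr0_real.
have r0 : 0 < complex.Re eps.
  by rewrite -(@ltcR R) -epsE rmorph0.
pose K' := `|K| + 1.
have K'0 : 0 < K' by rewrite ltr_wpDl.
pose dl := Num.min e (complex.Re eps / K').
have dl0 : 0 < dl by rewrite lt_min e0 divr_gt0.
near=> h.
have h0 : h != 0 by near: h; exact: nbhs_dnbhs_neq.
have hdl : cabs h <= dl.
  have : `|h| < dl%:C%C :> C.
    near: h; apply: dnbhs0_lt.
    by rewrite -(rmorph0 (real_complex R)) ltcR.
  by rewrite -cabsE ltcR => /ltW.
have := fa (h + x); rewrite addrK => /(_ (le_trans hdl _)) fah.
have {}fah : cabs (f (h + x) - f x - h * a) <= K * cabs h ^+ 2.
  by apply: fah; rewrite ge_min lexx.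
rewrite -cabsE epsE lecR.
have -> : a - h^-1 *: (f (h + x) - f x) = - (h^-1 * (f (h + x) - f x - h * a)).
  by rewrite /GRing.scale /=; field.
rewrite cabsN cabsM cabsV mulrC ler_pdivrMr ?cabs_gt0 //.
apply: (le_trans fah); rewrite expr2 mulrA ler_wpM2r ?cabs_ge0 //.
apply: le_trans (_ : K' * cabs h <= _).
  rewrite ler_wpM2r ?cabs_ge0 // /K'.
  by apply: le_trans (ler_norm K) _; rewrite lerDl.
rewrite mulrC -ler_pdivlMr //; apply: le_trans hdl _.
by rewrite ge_min lexx orbT.
Unshelve. all: by end_near. Qed.

Lemma cabs_subDr_le z x (s e : R) : cabs x <= s -> cabs (z - x) <= e -> cabs z <= s + e.
Proof.
move=> xs zx; have := cabsD x (z - x); rewrite subrKC => h.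
exact: le_trans h (lerD xs zx).
Qed.

(** Slope of the slope: the remainder $f(z)-f(x)-(z-x)q(x)$ equals $(z-x)^2q_2(z)$ with $q_2$
    bounded. *)
Lemma derive1_slope rho f q x : cabs x < rho -> rat_on rho q ->
  (forall z, cabs z <= rho -> f z - f x = (z - x) * q z) ->
  derive1 f x = q x.
Proof.
move=> xr rq fq; have rho0 : 0 < rho by apply: le_lt_trans xr; exact: cabs_ge0.
have [q2 [rq2 qq2]] := rat_on_slope (ltW xr) rq.
have [K q2K] := rat_on_bounded rho0 rq2.
apply: (@derive1_of_quadratic _ _ _ K (rho - cabs x)); first by rewrite subr_gt0.
move=> z zx; have zr : cabs z <= rho.
  by rewrite -(subrKC (cabs x) rho); exact: cabs_subDr_le zx.
rewrite fq // -mulrBr qq2 // mulrA cabsM -expr2 cabsX mulrC.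
by rewrite ler_wpM2r ?q2K // exprn_ge0 ?cabs_ge0.
Qed.

(** Two rounds of [slope_bound], each costing a factor $2/(\rho-s)$. *)
Lemma rat_taylor rho s f x M : 0 < rho -> s < rho -> cabs x <= s ->
  rat_on rho f -> (forall z, cabs z <= rho -> cabs (f z) <= M) ->
  cabs (derive1 f x) <= 2 * M / (rho - s) /\
  forall z, cabs z <= rho ->
    cabs (f z - f x - (z - x) * derive1 f x) <=
    4 * M / (rho - s) ^+ 2 * cabs (z - x) ^+ 2.
Proof.
move=> rho0 sr xs rf fM; have xr : cabs x < rho by exact: le_lt_trans sr.
have [q [rq fq]] := rat_on_slope (ltW xr) rf.
have qM := slope_bound rho0 sr xs rq fq fM.
have [q2 [rq2 qq2]] := rat_on_slope (ltW xr) rq.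
have q2M := slope_bound rho0 sr xs rq2 qq2 qM.
rewrite (derive1_slope xr rq fq); split; first by rewrite qM // ltW.
move=> z zr; rewrite fq // -mulrBr qq2 // mulrA cabsM -expr2 cabsX mulrC.
rewrite ler_wpM2r ?exprn_ge0 ?cabs_ge0 // (le_trans (q2M _ zr)) //.
rewrite le_eqVlt; apply/orP; left; apply/eqP; field.
by rewrite gt_eqF // subr_gt0.
Qed.

Lemma rat_lipschitz rho s f x M : 0 < rho -> s < rho -> cabs x <= s ->
  rat_on rho f -> (forall z, cabs z <= rho -> cabs (f z) <= M) ->
  forall z, cabs z <= rho ->
    cabs (f z - f x) <= 2 * M / (rho - s) * cabs (z - x).
Proof.
move=> rho0 sr xs rf fM z zr; have xr : cabs x < rho by exact: le_lt_trans sr.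
have [q [rq fq]] := rat_on_slope (ltW xr) rf.
by rewrite fq // cabsM mulrC ler_wpM2r ?cabs_ge0 // (slope_bound rho0 sr xs rq fq fM).
Qed.

(** Adding the first-order expansions at x and at z cancels the values of f and leaves
    $(f'(z)-f'(x))(z-x)$; this avoids second derivatives, and 8 is twice the constant 4 of
    [rat_taylor]. *)
Lemma derive1_lipschitz rho s f x z M : 0 < rho -> s < rho ->
  cabs x <= s -> cabs z <= s ->
  rat_on rho f -> (forall z, cabs z <= rho -> cabs (f z) <= M) ->
  cabs (derive1 f z - derive1 f x) <= 8 * M / (rho - s) ^+ 2 * cabs (z - x).
Proof.
move=> rho0 sr xs zs rf fM.
have [_ tx] := rat_taylor rho0 sr xs rf fM.
have [_ tz] := rat_taylor rho0 sr zs rf fM.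
have [->|zx] := eqVneq z x; first by rewrite !subrr cabs0 mulr0.
have zx0 : 0 < cabs (z - x) by rewrite cabs_gt0 subr_eq0.
rewrite -(ler_pM2r zx0) -cabsM.
have -> : (derive1 f z - derive1 f x) * (z - x) =
  (f z - f x - (z - x) * derive1 f x) + (f x - f z - (x - z) * derive1 f z).
  by move: (derive1 f z) (derive1 f x) => b a; ring.
apply: le_trans (cabsD _ _) _.
have := lerD (tx z (le_trans zs (ltW sr))) (tz x (le_trans xs (ltW sr))).
move=> h; apply: le_trans h _; rewrite [cabs (x - z)]cabsB.
by rewrite le_eqVlt; apply/orP; left; apply/eqP; field; rewrite gt_eqF // subr_gt0.
Qed.

Lemma derive1_rat_sub rho f g x : cabs x < rho -> rat_on rho f -> rat_on rho g ->
  derive1 (fun z => f z - g z) x = derive1 f x - derive1 g x.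
Proof.
move=> xr rf rg.
have [q [rq fq]] := rat_on_slope (ltW xr) rf.
have [p [rp gp]] := rat_on_slope (ltW xr) rg.
rewrite (derive1_slope xr rq fq) (derive1_slope xr rp gp).
apply: (derive1_slope xr (rat_onB rq rp)) => z zr.
by rewrite mulrBr -fq // -gp //; ring.
Qed.

End rational_functions.

(** * Schwarz-Pick lemma and uniform contraction of the pseudo-hyperbolic distance *)

Section schwarz_pick.
Context (R : realType).
Local Notation C := (Cplx R).
Implicit Types (f : C -> C) (z w x a b t : C) (rho r : R).

Lemma conjCR (x : R) : (x%:C%C : C)^* = x%:C%C.
Proof. by apply/CrealP/complex_realP; exists x. Qed.

Lemma cabs_disc_factor r a b :
  cabs ((r ^+ 2)%:C%C - a^* * b) ^+ 2 - r ^+ 2 * cabs (b - a) ^+ 2 =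
  (r ^+ 2 - cabs a ^+ 2) * (r ^+ 2 - cabs b ^+ 2).
Proof.
apply: (@complexI R).
rewrite rmorphB [X in _ - X]rmorphM [RHS]rmorphM /= ![in RHS]rmorphB /=.
rewrite !cabs_sqr !(rmorphB, rmorphM) /= conjCK.
rewrite !(conjCR, rmorphM) /= ?conjCR.
by ring.
Qed.

Lemma cabs_disc_factor_le r a b : 0 <= r -> cabs a <= r -> cabs b <= r ->
  r * cabs (b - a) <= cabs ((r ^+ 2)%:C%C - a^* * b).
Proof.
move=> r0 ar br.
rewrite -ler_sqr ?nnegrE ?mulr_ge0 ?cabs_ge0 // exprMn -subr_ge0.
by rewrite cabs_disc_factor mulr_ge0 // subr_ge0 lerXn2r ?nnegrE ?cabs_ge0.
Qed.

Lemma cabs_disc_factor_circle rho x z : 0 <= rho -> cabs z = rho ->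
  cabs ((rho ^+ 2)%:C%C - x^* * z) = rho * cabs (z - x).
Proof.
move=> rho0 zr.
apply: (@pexpIrn _ 2); rewrite ?nnegrE ?mulr_ge0 ?cabs_ge0 // exprMn.
by apply/eqP; rewrite -subr_eq0 cabs_disc_factor zr subrr mulr0.
Qed.

Lemma cabs_disc_denom_ge rho r a b : 0 <= r -> cabs a <= r -> cabs b <= r ->
  rho ^+ 2 - r ^+ 2 <= cabs ((rho ^+ 2)%:C%C - a^* * b).
Proof.
move=> r0 ar br; apply: le_trans (cabsB_ge _ _).
rewrite cabsR ger0_norm ?sqr_ge0 // lerD2l lerN2 cabsM cabs_conj expr2.
by rewrite ler_pM ?cabs_ge0.
Qed.

(** Maximum principle for the quotient h of the two pseudo-hyperbolic expressions, with the slope q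
    in place of $(f(y)-f(x))/(y-x)$ so that x is not a pole. On $|y|=\rho$ one has $|\rho^2-\bar
    xy|=\rho|y-x|$, which gives $|h|\le\rho/r$. *)
Lemma schwarz_pick rho r f : 0 < r -> 0 < rho -> rat_on rho f ->
  (forall z, cabs z <= rho -> cabs (f z) < r) ->
  forall x z, cabs x < rho -> cabs z <= rho ->
  r * cabs (f z - f x) * cabs ((rho ^+ 2)%:C%C - x^* * z) <=
  rho * cabs (z - x) * cabs ((r ^+ 2)%:C%C - (f x)^* * f z).
Proof.
move=> r0 rho0 rf fr x z xr zr.
have [q [rq fq]] := rat_on_slope (ltW xr) rf.
have den0 y : cabs y <= rho -> (r ^+ 2)%:C%C - (f x)^* * f y != 0.
  move=> yr; rewrite -cabs_gt0; apply: lt_le_trans (cabsB_ge _ _).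
  rewrite cabsR ger0_norm ?sqr_ge0 // cabsM cabs_conj subr_gt0 expr2.
  by rewrite ltr_pM ?cabs_ge0 // fr // ltW.
pose h y := q y * ((rho ^+ 2)%:C%C - x^* * y) / ((r ^+ 2)%:C%C - (f x)^* * f y).
have rh : rat_on rho h.
  apply: rat_onM.
    apply: rat_onM => //; apply: rat_onB; first exact: rat_on_cst.
    by apply: rat_onM; [exact: rat_on_cst|exact: rat_on_id].
  apply: rat_onV => //; apply: rat_onB; first exact: rat_on_cst.
  by apply: rat_onM => //; exact: rat_on_cst.
have hz : cabs (h z) <= rho / r.
  apply: rat_maximum_principle zr => // y yr.
  rewrite /h !cabsM cabsV ler_pdivrMr ?cabs_gt0 ?den0 ?yr //.
  rewrite cabs_disc_factor_circle ?(ltW rho0) // mulrCA [_ * cabs (y - x)]mulrC -cabsM.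
  rewrite -fq ?yr //.
  rewrite [leRHS]mulrAC ler_pdivlMr // -[leLHS]mulrA ler_pM2l // mulrC.
  by apply: cabs_disc_factor_le; rewrite ltW // fr // ?yr // ltW.
rewrite fq // cabsM.
move: hz; rewrite /h !cabsM cabsV ler_pdivrMr ?cabs_gt0 ?den0 //.
rewrite mulrAC ler_pdivlMr // => hz.
have := ler_wpM2l (cabs_ge0 (z - x)) hz.
by congr (_ <= _); ring.
Qed.

(** The ratio of the two moduli is largest at $t=-r^2$, where equality holds. The difference of the
    squares is a sum of two terms, nonnegative because $|t|\le r^2<\rho^2$ and
    $\mathrm{Re}\,t\ge-r^2$. *)
Lemma disc_factor_ratio rho r t : 0 < r -> r < rho -> cabs t <= r ^+ 2 ->
  (rho ^+ 2 + r ^+ 2) * cabs ((r ^+ 2)%:C%C - t) <=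
  2 * r ^+ 2 * cabs ((rho ^+ 2)%:C%C - t).
Proof.
move=> r0 rr tr; have rho0 := lt_trans r0 rr.
set A := r ^+ 2; set B := rho ^+ 2.
have A0 : 0 < A by rewrite exprn_gt0.
have AB : A < B by rewrite ltr_pXn2r ?nnegrE ?(ltW r0) ?(ltW rho0).
have BA0 : 0 <= B + A by rewrite addr_ge0 ?sqr_ge0.
have A20 : 0 <= 2 * A by rewrite mulr_ge0 // (ltW A0).
rewrite -ler_sqr ?nnegrE ?(mulr_ge0 BA0) ?(mulr_ge0 A20) ?cabs_ge0 //.
rewrite !exprMn !cabs_sqrE.
have := cabs_sqrE t; have : cabs t ^+ 2 <= A ^+ 2.
  by rewrite lerXn2r ?nnegrE ?cabs_ge0 // (ltW A0).
have : - A <= complex.Re t.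
  have := le_trans (cabs_Re t) tr; rewrite ler_norml => /andP[+ _].
  by rewrite -/A.
move: t tr => [u v] _ /=; move: (cabs _ ^+ 2) => m Au mA mE.
rewrite !add0r ?sub0r !sqrrN -subr_ge0.
have -> : 2 ^+ 2 * A ^+ 2 * ((B - u) ^+ 2 + v ^+ 2) -
   (B + A) ^+ 2 * ((A - u) ^+ 2 + v ^+ 2) =
   (A ^+ 2 - m) * ((A + B) ^+ 2 - (2 * A) ^+ 2) + 2 * A * (A - B) ^+ 2 * (A + u).
  by rewrite mE; ring.
apply: addr_ge0; last first.
  apply: mulr_ge0; last by lra.
  by apply: mulr_ge0; [exact: A20|exact: sqr_ge0].
have AB2 : 2 * A <= A + B by lra.
have AB0 : 0 <= A + B by lra.
by rewrite mulr_ge0 ?subr_ge0 // lerXn2r ?nnegrE.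
Qed.

(* The pseudo-hyperbolic distance of the disc of radius rho. *)
Definition pdist rho z w : R :=
  rho * cabs (z - w) / cabs ((rho ^+ 2)%:C%C - w^* * z).

(** The value of [pdist rho] between r and -r. It is also the product of the factor $\rho/r$ of
    [schwarz_pick] and the factor $2r^2/(\rho^2+r^2)$ of [disc_factor_ratio]. *)
Definition pdist_rate rho r : R := 2 * rho * r / (rho ^+ 2 + r ^+ 2).

Lemma pdist_rate_bounds rho r : 0 < r -> r < rho -> 0 <= pdist_rate rho r < 1.
Proof.
move=> r0 rr; have rho0 := lt_trans r0 rr.
have s0 : 0 < rho ^+ 2 + r ^+ 2 by rewrite addr_gt0 ?exprn_gt0.
rewrite /pdist_rate divr_ge0 ?mulr_ge0 ?ltW //= ltr_pdivrMr // mul1r.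
rewrite -subr_gt0 (_ : _ - _ = (rho - r) ^+ 2); last by ring.
by rewrite exprn_gt0 // subr_gt0.
Qed.

(** Schwarz-Pick compares the disc of radius rho with that of radius r; the strict gain comes from
    measuring the image again in the larger disc. *)
Lemma pdist_contraction rho r f : 0 < r -> r < rho -> rat_on rho f ->
  (forall z, cabs z <= rho -> cabs (f z) < r) ->
  forall z x, cabs z < rho -> cabs x < rho ->
  pdist rho (f z) (f x) <= pdist_rate rho r * pdist rho z x.
Proof.
move=> r0 rr rf fr z x zr xr; have rho0 := lt_trans r0 rr.
have den a b : cabs a < rho -> cabs b < rho ->
    0 < cabs ((rho ^+ 2)%:C%C - a^* * b).
  move=> ar br; apply: lt_le_trans (cabsB_ge _ _).
  rewrite cabsR ger0_norm ?sqr_ge0 // cabsM cabs_conj subr_gt0 expr2.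
  by rewrite ltr_pM ?cabs_ge0.
have fz := fr z (ltW zr); have fx := fr x (ltW xr).
have sp := schwarz_pick r0 rho0 rf fr xr (ltW zr).
have tr : cabs ((f x)^* * f z) <= r ^+ 2.
  by rewrite cabsM cabs_conj expr2 ler_pM ?cabs_ge0 ?ltW.
have dr := disc_factor_ratio r0 rr tr.
have d1 := den _ _ (lt_trans fx rr) (lt_trans fz rr).
have d2 := den _ _ xr zr.
have s0 : 0 < rho ^+ 2 + r ^+ 2 by rewrite addr_gt0 ?exprn_gt0.
rewrite /pdist /pdist_rate.
set F := cabs ((r ^+ 2)%:C%C - _) in sp dr.
set E := cabs ((rho ^+ 2)%:C%C - _) in dr d1 *.
set G := cabs ((rho ^+ 2)%:C%C - _) in sp d2 *.
set s := rho ^+ 2 + r ^+ 2 in s0 dr *.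
have a0 := cabs_ge0 (z - x); set a := cabs (z - x) in a0 sp *.
set c := cabs (f z - f x) in sp *.
have k : c * G * s <= 2 * rho * a * r * E.
  rewrite -(ler_pM2l r0) (_ : r * _ = (r * c * G) * s); last by ring.
  apply: le_trans (ler_wpM2r (ltW s0) sp) _.
  rewrite (_ : rho * a * F * s = rho * a * (s * F)); last by ring.
  apply: le_trans (ler_wpM2l (mulr_ge0 (ltW rho0) a0) dr) _.
  by rewrite le_eqVlt; apply/orP; left; apply/eqP; ring.
rewrite ler_pdivrMr //.
rewrite [leRHS](_ : _ = 2 * rho * r * rho * a * E / (G * s)); last first.
  by field; rewrite !gt_eqF.
rewrite ler_pdivlMr ?mulr_gt0 //.
have := ler_wpM2l (ltW rho0) k.
by congr (_ <= _); ring.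
Qed.

Lemma pdist_le rho r z w : 0 <= r -> r < rho -> cabs z <= r -> cabs w <= r ->
  pdist rho z w <= rho / (rho ^+ 2 - r ^+ 2) * cabs (z - w).
Proof.
move=> r0 rr zr wr; have rho0 := le_lt_trans r0 rr.
have d0 : 0 < rho ^+ 2 - r ^+ 2.
  by rewrite subr_gt0 ltr_pXn2r ?nnegrE ?(ltW rho0).
have d1 := cabs_disc_denom_ge rho r0 wr zr.
rewrite /pdist mulrAC ler_wpM2r ?cabs_ge0 // ler_wpM2l ?(ltW rho0) //.
by rewrite lef_pV2 ?posrE // (lt_le_trans d0).
Qed.

Lemma cabs_le_pdist rho z w : 0 < rho -> cabs z < rho -> cabs w < rho ->
  cabs (z - w) <= 2 * rho * pdist rho z w.
Proof.
move=> rho0 zr wr; rewrite /pdist.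
have wz : cabs (w^* * z) < rho ^+ 2.
  by rewrite cabsM cabs_conj expr2 ltr_pM ?cabs_ge0.
have d0 : 0 < cabs ((rho ^+ 2)%:C%C - w^* * z).
  apply: lt_le_trans (cabsB_ge _ _).
  by rewrite cabsR ger0_norm ?sqr_ge0 // subr_gt0.
rewrite mulrA ler_pdivlMr // mulrA [leRHS]mulrC ler_wpM2l ?cabs_ge0 //.
apply: le_trans (cabsB_le _ _) _.
by rewrite cabsR ger0_norm ?sqr_ge0 //; move: (cabs _) wz => t; lra.
Qed.

End schwarz_pick.

(** * Finite Blaschke products and disc automorphisms *)

Section blaschke_products.
Context (R : realType).
Local Notation C := (Cplx R).
Implicit Types (f g : C -> C) (z w x c zeta : C) (a b : nat -> C).

(** Degree 0 is allowed: removing the zero of a product of degree 1 leaves a unimodular constant. *)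
Definition is_blaschke n f := exists zeta a,
  [/\ cabs zeta = 1, forall j, (j < n)%N -> cabs (a j) < 1 & f = blaschke n zeta a].

Lemma is_blaschke_rat_on n f : is_blaschke n f -> rat_on 1 f.
Proof.
move=> [zeta [a [_ a1 ->]]]; apply: rat_onM; first exact: rat_on_cst.
apply: rat_on_prod => j; apply: rat_onM.
  by apply: rat_onB; [exact: rat_on_id|exact: rat_on_cst].
apply: rat_onV; last by move=> z; apply: subr1_conjM_neq0; exact: a1.
apply: rat_onB; first exact: rat_on_cst.
by apply: rat_onM; [exact: rat_on_cst|exact: rat_on_id].
Qed.

Lemma is_blaschke_le1 n f z : is_blaschke n f -> cabs z <= 1 -> cabs (f z) <= 1.
Proof.
move=> [zeta [a [zeta1 a1 ->]]] z1; rewrite /blaschke cabsM zeta1 mul1r cabs_prod.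
apply: Num.Theory.prodr_ile1 => j _; rewrite cabs_ge0 cabs_div ler_pdivrMr ?mul1r.
  by rewrite cabs_blaschke_factor_le // ltW // a1.
by rewrite cabs_gt0 subr1_conjM_neq0 // a1.
Qed.

(** A size bound with a coefficient, not an exact degree: in the denominator of a Blaschke product
    [u j] is $-\bar a_j$, which may vanish. *)
Lemma prod_affine_coef (u v : nat -> C) n :
  let P := \prod_(j < n) ((u j)%:P * 'X + (v j)%:P) in
  (size P <= n.+1)%N /\ P`_n = \prod_(j < n) u j.
Proof.
elim: n => [|n [IHs IHc]] /=; first by rewrite !big_ord0 size_poly1 coef1.
rewrite !big_ord_recr /=; set P := \prod_(_ < n) _ in IHs IHc *; split.
  rewrite (leq_trans (size_polyMleq _ _)) //.
  have h : (size ((u n)%:P * 'X + (v n)%:P)%R <= 2)%N.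
    by rewrite size_MXaddC; case: ifP => // _; rewrite ltnS size_polyC_leq1.
  rewrite -subn1 leq_subLR; apply: leq_trans (leq_add IHs h) _.
  by rewrite addn2 add1n.
rewrite mulrDr coefD mulrA coefMX /= coefMC coefMC IHc.
by rewrite (nth_default 0 IHs) mul0r addr0.
Qed.

(* The numerator N + c D of (f + c) / (1 + c^* f), where f = N / D, splits over
   C; since |N| >= |D| outside the disc and |c| < 1, its roots are in the disc,
   and reflecting it across the circle gives the denominator. *)
Lemma is_blaschke_mobius n f c : is_blaschke n f -> cabs c < 1 ->
  exists g, is_blaschke n g /\
    forall z, cabs z <= 1 -> g z = (f z + c) / (1 + c^* * f z).
Proof.
move=> [zeta [a [zeta1 a1 fE]]] c1.
pose N : {poly C} := zeta%:P * \prod_(j < n) (1%:P * 'X + (- a j)%:P).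
pose D : {poly C} := \prod_(j < n) ((- (a j)^*)%:P * 'X + 1%:P).
pose p := N + c%:P * D.
pose l := zeta + c * \prod_(j < n) (- (a j)^*).
have NE z : N.[z] = zeta * \prod_(j < n) (z - a j).
  rewrite /N hornerM hornerC horner_prod; congr (_ * _).
  by apply: eq_bigr => j _; rewrite !hornerE.
have DE z : D.[z] = \prod_(j < n) (1 - (a j)^* * z).
  by rewrite /D horner_prod; apply: eq_bigr => j _; rewrite !hornerE addrC mulNr.
have [sN cN] := prod_affine_coef (fun=> 1) (fun j => - a j) n.
have [sD cD] := prod_affine_coef (fun j => - (a j)^*) (fun=> 1) n.
have pn : p`_n = l.
  by rewrite coefD !coefCM cN cD big1 ?mulr1.
have zeta0 : zeta != 0 by rewrite -cabs_gt0 zeta1.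
have prod1 : cabs (\prod_(j < n) (- (a j)^*)) <= 1.
  rewrite cabs_prod; apply: Num.Theory.prodr_ile1 => j _.
  by rewrite cabsN cabs_conj cabs_ge0 ltW // a1.
(* Since $|l|\ge1-|c|>0$, the degree of p is exactly n. *)
have l0 : l != 0.
  rewrite -cabs_gt0; apply: lt_le_trans (cabsD_ge _ _).
  rewrite zeta1 cabsM subr_gt0; apply: le_lt_trans c1.
  by rewrite ler_piMr ?cabs_ge0.
have sp : size p = n.+1.
  apply/eqP; rewrite eqn_leq; apply/andP; split.
    rewrite (leq_trans (size_polyD _ _)) // geq_max.
    rewrite /N [zeta%:P * _]mul_polyC [c%:P * _]mul_polyC.
    by rewrite !(leq_trans (size_scale_leq _ _)).
  rewrite ltnNge; apply/negP => /leq_sizeP/(_ n (leqnn n)) /eqP.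
  by rewrite pn (negbTE l0).
have lp : lead_coef p = l by rewrite lead_coefE sp.
have [rs prs] := closed_field_poly_normal p.
have srs : size rs = n.
  move: sp; rewrite prs lp size_scale // size_prod_XsubC.
  by move=> [].
pose b j := nth 0 rs j.
have E1 w : zeta * \prod_(j < n) (w - a j) + c * \prod_(j < n) (1 - (a j)^* * w)
    = l * \prod_(j < n) (w - b j).
  rewrite -NE -DE -[in c * _](hornerC c w) -hornerM -hornerD -/p prs lp.
  rewrite hornerZ horner_prod (big_nth 0) srs big_mkord; congr (_ * _).
  by apply: eq_bigr => j _; rewrite !hornerE.
have b1 j : (j < n)%N -> cabs (b j) < 1.
  move=> jn; rewrite ltNge; apply/negP => bj.
  have := E1 (b j); rewrite [in RHS](bigD1 (Ordinal jn)) //= subrr mul0r mulr0.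
  move=> /eqP; rewrite addr_eq0 => /eqP/(congr1 (@cabs R)).
  rewrite cabsN !cabsM zeta1 mul1r !cabs_prod => e.
  have h1 : \prod_(i < n) cabs (1 - (a i)^* * b j) <= \prod_(i < n) cabs (b j - a i).
    apply: ler_prod => i _; rewrite cabs_ge0 /=.
    by apply: cabs_blaschke_factor_ge => //; rewrite ltW // a1.
  have h2 : 0 < \prod_(i < n) cabs (b j - a i).
    apply: prodr_gt0 => i _; rewrite cabs_gt0 subr_eq0; apply/eqP => ba.
    by have := a1 _ (ltn_ord i); rewrite -ba ltNge bj.
  have := ler_wpM2l (cabs_ge0 c) h1; rewrite -e leNgt => /negP; apply.
  by rewrite gtr_pMl.
have lC : l^* = zeta^* + c^* * \prod_(j < n) (- a j).
  rewrite /l rmorphD rmorphM rmorph_prod /=; congr (_ + _ * _).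
  by apply: eq_bigr => j _; rewrite rmorphN /= conjCK.
have E2 z : zeta^* * \prod_(j < n) (1 - (a j)^* * z) + c^* * \prod_(j < n) (z - a j)
    = l^* * \prod_(j < n) (1 - (b j)^* * z).
  (* For nonzero z this is [E1] at $1/\bar z$, conjugated and multiplied by $z^n$; at 0 the
     reflection is undefined and both sides are evaluated directly. *)
  have [->|z0] := eqVneq z 0.
    rewrite lC [X in zeta^* * X]big1 ?[X in _ = _ * X]big1 ?mulr1.
    - by congr (_ + _ * _); apply: eq_bigr => j _; rewrite sub0r.
    - by move=> j _; rewrite mulr0 subr0.
    - by move=> j _; rewrite mulr0 subr0.
  have reflect1 (d : nat -> C) : (\prod_(j < n) ((z^-1)^* - d j))^* * \prod_(j < n) z =
      \prod_(j < n) (1 - (d j)^* * z).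
    rewrite rmorph_prod -big_split /=; apply: eq_bigr => j _.
    by rewrite rmorphB /= conjCK mulrBl mulVf.
  have reflect2 (d : nat -> C) : (\prod_(j < n) (1 - (d j)^* * (z^-1)^*))^* *
      \prod_(j < n) z = \prod_(j < n) (z - d j).
    rewrite rmorph_prod -big_split /=; apply: eq_bigr => j _.
    by rewrite rmorphB rmorphM rmorph1 /= !conjCK mulrBl mul1r mulfVK.
  have := congr1 (fun t => t^* * \prod_(j < n) z) (E1 (z^-1)^*).
  rewrite rmorphD !rmorphM /= mulrDl -!mulrA.
  by rewrite !reflect1 reflect2.
have lC0 : l^* != 0 by rewrite conjC_eq0.
have zzC : zeta^* = zeta^-1.
  apply: (mulIf zeta0); rewrite mulVf // mulrC -cabs_sqr zeta1 expr1n.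
  by rewrite rmorph1.
(* [E1] gives the numerator of the quotient and zeta times [E2] its denominator; the constants left
   are $l$ over $\zeta\bar l$. *)
exists (blaschke n (l / (zeta * l^*)) b); split.
  exists (l / (zeta * l^*)), b; split=> //.
  by rewrite cabs_div cabsM zeta1 mul1r cabs_conj divff // cabs_eq0.
move=> z z1; rewrite fE /blaschke !prodf_div.
have := E1 z; have := E2 z; rewrite zzC.
have : \prod_(j < n) (1 - (b j)^* * z) != 0.
  by apply/prodf_neq0 => j _; rewrite subr1_conjM_neq0 // b1.
have : \prod_(j < n) (1 - (a j)^* * z) != 0.
  by apply/prodf_neq0 => j _; rewrite subr1_conjM_neq0 // a1.
move: (\prod_(j < n) (1 - (a j)^* * z)) (\prod_(j < n) (1 - (b j)^* * z)) => A B.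
move: (\prod_(j < n) (z - a j)) (\prod_(j < n) (z - b j)) => A' B' A0 B0 e2 e1.
have e3 : A + c^* * zeta * A' = zeta * l^* * B.
  by rewrite -[RHS]mulrA -e2; field.
have d0 : A + c^* * zeta * A' != 0 by rewrite e3 !mulf_neq0.
rewrite [RHS](_ : _ = (zeta * A' + c * A) / (A + c^* * zeta * A')).
  by rewrite e1 e3; field; rewrite B0 lC0.
by field; rewrite A0 /= d0.
Qed.

Lemma is_blaschke_mul_factor n g x : is_blaschke n g -> cabs x < 1 ->
  is_blaschke n.+1 (fun z => (z - x) / (1 - x^* * z) * g z).
Proof.
move=> [zeta [a [zeta1 a1 gE]]] x1.
exists zeta, (fun j => if j is k.+1 then a k else x); split=> //.
  by case=> // j; exact: a1.
by apply/funext => z; rewrite gE /blaschke big_ord_recl /= mulrCA.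
Qed.

Lemma is_blaschke_zero_factor n f x : is_blaschke n f -> cabs x < 1 -> f x = 0 ->
  exists m g, [/\ n = m.+1, is_blaschke m g &
    forall z, f z = (z - x) / (1 - x^* * z) * g z].
Proof.
move=> [zeta [a [zeta1 a1 fE]]] x1; rewrite fE /blaschke => /eqP.
have zeta0 : zeta != 0 by rewrite -cabs_gt0 zeta1.
rewrite mulf_eq0 (negbTE zeta0) /= => /prodf_eq0[j _].
rewrite mulf_eq0 invr_eq0 (negbTE (subr1_conjM_neq0 (a1 _ (ltn_ord j)) (ltW x1))).
rewrite orbF subr_eq0 => /eqP xa.
case: n a1 {fE} f j xa => [|n] a1 f j xa; first by case: j xa.
exists n, (blaschke n zeta (fun k => a (bump j k))); split=> //.
  exists zeta, (fun k => a (bump j k)); split=> // k kn; apply: a1.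
  exact: (ltn_ord (lift j (Ordinal kn))).
by move=> z; rewrite xa /blaschke (bigD1_ord j) //= mulrCA.
Qed.

End blaschke_products.

(** * Perturbing a Blaschke product with its value at one point fixed *)

Section blaschke_perturbation.
Context (R : realType).
Local Notation C := (Cplx R).
Implicit Types (f g : C -> C) (z w x c : C).

Lemma addr1_conjM_ge (r0 : R) c w : cabs c <= r0 -> cabs w <= 1 ->
  1 - r0 <= cabs (1 + c^* * w).
Proof.
move=> cr w1; apply: le_trans (cabsD_ge _ _).
rewrite cabs1 cabsM cabs_conj lerD2l lerN2; apply: le_trans cr.
by rewrite ler_piMr ?cabs_ge0.
Qed.

(** If $|f(x)|<c_0$, the automorphism with $|c|=2c_0$ sends f(x) to a quotient with numerator at
    least $c_0$ and denominator at most 2. The displacement $(c-\bar cf^2)/(1+\bar cf)$ is at most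
    $4c_0$ over $1/2$. *)
Lemma blaschke_avoid_zero n f x (c0 : R) : 0 < c0 -> c0 <= 4^-1 ->
  is_blaschke n f -> cabs x <= 1 ->
  exists g, [/\ is_blaschke n g, c0 / 2 <= cabs (g x) &
    forall z, cabs z <= 1 -> cabs (g z - f z) <= 8 * c0].
Proof.
move=> c00 c04 bf x1; have [c0f|fc0] := leP c0 (cabs (f x)).
  exists f; split=> // [|z _]; first by lra.
  by rewrite subrr cabs0 mulr_ge0 // ltW.
have [c cc] : exists c : C, cabs c = 2 * c0.
  by exists (2 * c0)%:C%C; rewrite cabsR ger0_norm // mulr_ge0 // ltW.
have c1 : cabs c < 1 by rewrite cc; lra.
have [g [bg gE]] := is_blaschke_mobius bf c1.
have den z : cabs z <= 1 -> 1 - 2 * c0 <= cabs (1 + c^* * f z).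
  by move=> z1; apply: addr1_conjM_ge; rewrite ?cc ?(is_blaschke_le1 bf).
have den0 z : cabs z <= 1 -> 0 < cabs (1 + c^* * f z).
  by move=> /den; apply: lt_le_trans; lra.
exists g; split=> // [|z z1].
  rewrite gE // cabs_div ler_pdivlMr ?den0 //.
  apply: le_trans (_ : c0 <= _); last first.
    by rewrite addrC; apply: le_trans (cabsD_ge _ _); rewrite cc; lra.
  have : cabs (1 + c^* * f x) <= 2.
    apply: le_trans (cabsD _ _) _; rewrite cabs1 cabsM cabs_conj cc.
    have : 2 * c0 * cabs (f x) <= 2 * c0 * 1.
      by rewrite ler_wpM2l ?(is_blaschke_le1 bf) // mulr_ge0 // ltW.
    by lra.
  by move=> /(ler_wpM2l (ltW c00)) h; rewrite mulrAC ler_pdivrMr.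
have -> : g z - f z = (c - c^* * f z * f z) / (1 + c^* * f z).
  have d0 : 1 + c^* * f z != 0 by rewrite -cabs_gt0 den0.
  by rewrite gE //; field.
rewrite cabs_div ler_pdivrMr ?den0 //.
apply: le_trans (_ : 4 * c0 <= _).
  apply: le_trans (cabsB_le _ _) _; rewrite !cabsM cabs_conj cc -mulrA.
  have : cabs (f z) * cabs (f z) <= 1.
    by rewrite -[leRHS]mulr1 ler_pM ?cabs_ge0 ?(is_blaschke_le1 bf).
  by move=> /(@ler_wpM2l _ (2 * c0)); rewrite mulr_ge0 ?(ltW c00) // => /(_ isT); lra.
have := den z z1; move: (cabs _) => t tt.
have : 0 <= c0 * (t - 2^-1) by rewrite mulr_ge0 ?(ltW c00) //; lra.
by lra.
Qed.

(* Conjugating by disc automorphisms one may assume x = f x = 0, so that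
   f z = z B(z) with B a Blaschke product and f'(0) = B(0); B is then moved
   away from 0 by a small disc automorphism. *)
Lemma blaschke_perturbation (r0 eps : R) : 0 <= r0 -> r0 < 1 -> 0 < eps ->
  exists2 dl, 0 < dl & forall n f x,
    is_blaschke n f -> cabs x <= r0 -> cabs (f x) <= r0 ->
    exists g, [/\ is_blaschke n g, g x = f x, dl <= cabs (derive1 g x) &
      forall z, cabs z <= 1 -> cabs (g z - f z) <= eps].
Proof.
move=> r00 r01 eps0.
have r0' : 0 < 1 - r0 by rewrite subr_gt0.
(* The second bound pays for undoing the automorphism on the value side: this multiplies distances
   by at most $1/(1-r_0)^2$. *)
pose c0 := Num.min 4^-1 (eps * (1 - r0) ^+ 2 / 8).
have c00 : 0 < c0 by rewrite lt_min invr_gt0 ltr0n /= divr_gt0 // mulr_gt0 // exprn_gt0.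
have c04 : c0 <= 4^-1 by rewrite ge_min lexx.
have c0e : 8 * c0 <= eps * (1 - r0) ^+ 2.
  by rewrite mulrC -ler_pdivlMr // ge_min lexx orbT.
have r02 : r0 ^+ 2 < 1 by rewrite expr_lt1.
(* The derivative will be $g'(x)=(1-|y|^2)\hat B(x)/(1-|x|^2)$, where $\hat B$ is [Bh] and $|\hat
   B(x)|\ge c_0/2$. *)
exists ((1 - r0 ^+ 2) * (c0 / 2)).
  by rewrite mulr_gt0 ?subr_gt0 // divr_gt0.
move=> n f x bf xr; set y := f x => yr.
have x1 : cabs x < 1 by exact: le_lt_trans r01.
have y1 : cabs y < 1 by exact: le_lt_trans r01.
have f1 := is_blaschke_le1 bf.
have Ny1 : cabs (- y) < 1 by rewrite cabsN.
have [G [bG GE]] := is_blaschke_mobius bf Ny1.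
have Gx : G x = 0 by rewrite GE ?ltW // -/y subrr mul0r.
(* Instead of moving x to 0, the Blaschke factor vanishing at x is split off. *)
have [m [B [nm bB GB]]] := is_blaschke_zero_factor bG x1 Gx.
have [Bh [bBh Bhx BhB]] := blaschke_avoid_zero c00 c04 bB (ltW x1).
pose S z := (z - x) / (1 - x^* * z) * Bh z.
have bS : is_blaschke n S by rewrite nm; exact: is_blaschke_mul_factor.
have [g [bg gE]] := is_blaschke_mobius bS y1.
have den w : cabs w <= 1 -> 1 - r0 <= cabs (1 + y^* * w).
  by move=> w1; exact: addr1_conjM_ge.
have den0 w : cabs w <= 1 -> 1 + y^* * w != 0.
  by move=> /den h; rewrite -cabs_gt0; exact: lt_le_trans h.
have S1 := is_blaschke_le1 bS; have G1 := is_blaschke_le1 bG.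
have yy : 1 - y * y^* != 0.
  by have := den0 (- y); rewrite cabsN mulrN mulrC; apply; exact: ltW.
have yyr : 1 - r0 ^+ 2 <= cabs (1 - y * y^*).
  apply: le_trans (cabsB_ge _ _); rewrite cabs1 cabsM cabs_conj lerD2l lerN2.
  by rewrite expr2 ler_pM ?cabs_ge0.
have xx : 1 - x^* * x != 0 by rewrite subr1_conjM_neq0 ?ltW.
have fG z : cabs z <= 1 -> f z = (G z + y) / (1 + y^* * G z).
  move=> z1; apply: (mulIf (den0 _ (G1 z z1))); rewrite divfK ?den0 ?G1 //.
  have d0 : 1 + (- y)^* * f z != 0.
    by rewrite rmorphN mulNr subr1_conjM_neq0 // f1.
  by move: d0; rewrite GE // rmorphN /= => d0; field.
have gx : g x = y.
  by rewrite gE ?(ltW x1) // /S subrr !mul0r mulr0 add0r addr0 divr1.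
exists g; split=> //.
(* Closed form of the slope of g at x, from $g-y=(1-|y|^2)S/(1+\bar yS)$. *)
- pose q z := (1 - y * y^*) * Bh z / (1 - x^* * z) / (1 + y^* * S z).
  have rB := is_blaschke_rat_on bBh; have rS := is_blaschke_rat_on bS.
  have rq : rat_on 1 q.
    apply: rat_onM; last first.
      apply: rat_onV; last by move=> z z1; rewrite den0 // S1.
      apply: rat_onD; first exact: rat_on_cst.
      by apply: rat_onM => //; exact: rat_on_cst.
    apply: rat_onM; last first.
      apply: rat_onV; last by move=> z z1; rewrite subr1_conjM_neq0.
      apply: rat_onB; first exact: rat_on_cst.
      by apply: rat_onM; [exact: rat_on_cst|exact: rat_on_id].
    by apply: rat_onM => //; exact: rat_on_cst.
  rewrite (derive1_slope x1 rq); last first.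
    move=> z z1; rewrite gx gE // /q.
    have d1 := den0 _ (S1 z z1); have d2 := subr1_conjM_neq0 x1 z1.
    rewrite [LHS](_ : _ = (1 - y * y^*) * S z / (1 + y^* * S z)); last by field.
    by rewrite {1}/S; field; rewrite d1.
  rewrite /q /S subrr !mul0r mulr0 addr0 divr1 !cabsM cabsV -mulrA.
  apply: ler_pM => //; first by rewrite subr_ge0 ltW.
    by rewrite divr_ge0 // ltW.
  rewrite ler_pdivlMr ?cabs_gt0 //; apply: le_trans Bhx.
  apply: ler_piMr; first by rewrite divr_ge0 // ltW.
  rewrite mulrC -cabs_sqr -(rmorph1 (real_complex R)) -rmorphB cabsR.
  by rewrite ger0_norm ?subr_ge0 ?lerBlDr ?lerDl ?sqr_ge0 // expr_le1 ?cabs_ge0 // ltW.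
- move=> z z1; have d1 := den0 _ (S1 z z1); have d2 := den0 _ (G1 z z1).
  rewrite gE // fG //.
  rewrite (_ : _ - _ =
    (1 - y * y^*) * (S z - G z) / ((1 + y^* * S z) * (1 + y^* * G z))); last first.
    by field; rewrite d1 d2.
  have SG : cabs (S z - G z) <= 8 * c0.
    rewrite GB /S -mulrBr cabsM; apply: le_trans (_ : 1 * (8 * c0) <= _); last by rewrite mul1r.
    apply: ler_pM; rewrite ?cabs_ge0 ?BhB // cabs_div ler_pdivrMr ?mul1r.
      by rewrite cabs_blaschke_factor_le // ltW.
    by rewrite cabs_gt0 subr1_conjM_neq0.
  rewrite cabs_div ler_pdivrMr ?cabs_gt0 ?mulf_neq0 // !cabsM.
  apply: le_trans (_ : 1 * (8 * c0) <= _).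
    apply: ler_pM; rewrite ?cabs_ge0 // -cabs_sqr.
    rewrite -(rmorph1 (real_complex R)) -rmorphB cabsR.
    by rewrite ger0_norm ?subr_ge0 ?lerBlDr ?lerDl ?sqr_ge0 // expr_le1 ?cabs_ge0 // ltW.
  rewrite mul1r; apply: (le_trans c0e); rewrite ler_wpM2l ?(ltW eps0) // expr2.
  by apply: ler_pM; rewrite ?(ltW r0') // den ?S1 ?G1.
Qed.

End blaschke_perturbation.

(** * Countable measurable partitions *)

Section countable_partitions.
Context (d : measure_display) (Omega : measurableType d).
Implicit Types (A B : Omega -> Omega -> Prop) (k : Omega -> nat).

Definition measurable_fibers k := forall i, measurable (k @^-1` [set i]).

Lemma measurable_fibers_preimage k (Y : set nat) :
  measurable_fibers k -> measurable (k @^-1` Y).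
Proof.
move=> mk; rewrite (_ : k @^-1` Y = \bigcup_(i in Y) (k @^-1` [set i])).
  by apply: bigcup_measurable => i _; exact: mk.
by apply/seteqP; split=> [w Yw|w [i Yi /= ->]//]; exists (k w).
Qed.

(** The fibers of k are the cells of the partition; A is meant to be a closeness relation, such as
    being within [eta] for some function. *)
Definition constant_on_fibers A :=
  exists k, measurable_fibers k /\ forall w w', k w = k w' -> A w w'.

Lemma constant_on_fibers_imp A B : (forall w w', A w w' -> B w w') ->
  constant_on_fibers A -> constant_on_fibers B.
Proof. by move=> AB [k [mk kA]]; exists k; split=> // w w' /kA/AB. Qed.

(** Disjointification: [k w] is the least code of a set of the cover containing w. *)
Lemma constant_on_fibers_cover (I : countType) (E : I -> set Omega) :
  (forall i, measurable (E i)) -> (forall w, exists i, E i w) ->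
  constant_on_fibers (fun w w' => exists i, E i w /\ E i w').
Proof.
move=> mE cE.
pose F m : set Omega := if unpickle m is Some i then E i else set0.
have mF m : measurable (F m) by rewrite /F; case: unpickle.
have exF w : exists m, `[< F m w >].
  by have [i Ei] := cE w; exists (pickle i); apply/asboolP; rewrite /F pickleK.
pose k w := ex_minn (exF w).
have kF w : F (k w) w by rewrite /k; case: ex_minnP => m /asboolP.
have kmin w j : F j w -> (k w <= j)%N.
  by rewrite /k; case: ex_minnP => m _ h Fj; apply: h; apply/asboolP.
exists k; split=> [m|w w' kww'].
  have -> : k @^-1` [set m] = F m `\` \bigcup_(j in `I_m) F j.
    apply/seteqP; split=> [w /= <-|w [Fm /= nF]].
      by split=> // -[j /= jk /kmin]; rewrite leqNgt jk.
    apply/eqP; rewrite eqn_leq kmin //= leqNgt; apply/negP => km.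
    by apply: nF; exists (k w).
  by apply: measurableD => //; apply: bigcup_measurable.
have := kF w; have := kF w'; rewrite -kww' /F.
by case: unpickle => // i; exists i.
Qed.

Lemma constant_on_fibers_and A B : constant_on_fibers A -> constant_on_fibers B ->
  constant_on_fibers (fun w w' => A w w' /\ B w w').
Proof.
move=> [k [mk kA]] [l [ml lB]].
pose E (i : nat * nat) := (k @^-1` [set i.1]) `&` (l @^-1` [set i.2]).
have mE i : measurable (E i) by apply: measurableI; [exact: mk|exact: ml].
have cE w : exists i, E i w by exists (k w, l w).
apply: constant_on_fibers_imp (constant_on_fibers_cover mE cE).
move=> w w' [i [[/= k1 l1] [k2 l2]]].
by split; [apply: kA; rewrite k1 k2|apply: lB; rewrite l1 l2].
Qed.

Lemma constant_on_fibers_comp A (t : Omega -> Omega) :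
  measurable_fun [set: Omega] t -> constant_on_fibers A ->
  constant_on_fibers (fun w w' => A (t w) (t w')).
Proof.
move=> mt [k [mk kA]]; exists (k \o t); split=> [i|w w' /kA//].
by rewrite comp_preimage -[_ @^-1` _]setTI; apply: mt.
Qed.

Lemma constant_on_fibers_set (G : set Omega) : measurable G ->
  constant_on_fibers (fun w w' => G w <-> G w').
Proof.
move=> mG; pose E (b : bool) := if b then G else ~` G.
have mE b : measurable (E b) by case: b => //=; exact: measurableC.
have cE w : exists b, E b w.
  by have [Gw|nGw] := pselect (G w); [exists true|exists false].
apply: constant_on_fibers_imp (constant_on_fibers_cover mE cE).
by move=> w w' [[]/= [? ?]].
Qed.

End countable_partitions.

(** * Borel measurability as approximate constancy on countable partitions *)

Section borel_discretization.
Context (R : realType) (d : measure_display) (Omega : measurableType d).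
Local Notation C := (Cplx R).
Implicit Types (f : Omega -> C) (k : Omega -> nat).

(** Equivalent to Borel measurability, by separability of the plane: see [borel_fun_almost_discrete]
    and [almost_discrete_borel_fun]. *)
Definition almost_discrete f := forall eta : R, 0 < eta ->
  constant_on_fibers (fun w w' => cabs (f w - f w') <= eta).

Definition cplx_rat (p : rat * rat) : C := Complex (ratr p.1) (ratr p.2).

Lemma cplx_rat_dense (z : C) (e : R) : 0 < e -> exists p, cabs (z - cplx_rat p) < e.
Proof.
move=> e0; have near_rat (x : R) : exists q : rat, `|x - ratr q| < e / 2.
  have xe : x - e / 2 < x + e / 2 by lra.
  have [q] := rat_in_itvoo xe; rewrite in_itv /= => /andP[h1 h2]; exists q.
  by rewrite ltr_norml; apply/andP; split; lra.
case: z => x y; have [p px] := near_rat x; have [q qy] := near_rat y.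
exists (p, q); apply: le_lt_trans (cabs_le_ReIm _) _ => /=.
by rewrite [ltRHS](splitr e) ltrD.
Qed.

Lemma cplx_ball_nbhs (U : set C) (z : C) : open U -> U z ->
  exists2 e : R, 0 < e & forall w, cabs (z - w) < e -> U w.
Proof.
move=> oU Uz; have /nbhs_ballP[e /= e0 eU] := open_nbhs_nbhs (conj oU Uz).
have eE : e = (complex.Re e)%:C%C by rewrite RRe_real // gtr0_real.
exists (complex.Re e); first by rewrite -(@ltcR R) -eE rmorph0.
move=> w zw; apply: eU; rewrite -ball_normE /= -cabsE eE.
by rewrite ltcR.
Qed.

Lemma cplx_ball_open (c : C) (e : R) : open [set z : C | cabs (z - c) < e].
Proof.
rewrite (_ : [set _ | _] = ball c (e%:C%C : C)); last first.
  by apply/seteqP; split=> z /=; rewrite -ball_normE /= -cabsE ltcR cabsB.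
have [e0|e0] := ltP 0 e; last first.
  rewrite (_ : ball _ _ = set0); first exact: open0.
  apply/seteqP; split=> z //=; rewrite -ball_normE /= -cabsE ltcR => h.
  by have := le_lt_trans (cabs_ge0 _) (lt_le_trans h e0); rewrite ltxx.
by apply: ball_open; rewrite -(rmorph0 (real_complex R)) ltcR.
Qed.

Lemma borel_fun_ball (D : set Omega) f (c : C) (e : R) : measurable D ->
  borel_fun D f -> measurable (D `&` [set w | cabs (f w - c) < e]).
Proof.
move=> mD bf; apply: (bf mD [set z : C | cabs (z - c) < e]).
by apply: sub_sigma_algebra; exact: cplx_ball_open.
Qed.

Lemma borel_fun_almost_discrete f : borel_fun [set: Omega] f -> almost_discrete f.
Proof.
move=> bf eta eta0.
pose E (p : rat * rat) := [set w | cabs (f w - cplx_rat p) < eta / 2].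
have mE p : measurable (E p).
  by rewrite -[E p]setTI; apply: borel_fun_ball.
have cE w : exists p, E p w by apply: cplx_rat_dense; rewrite divr_gt0.
apply: constant_on_fibers_imp (constant_on_fibers_cover mE cE).
move=> w w' [p [Ew Ew']]; apply: le_trans (cabs_dist_triangle _ (cplx_rat p) _) _.
by rewrite [leRHS](splitr eta) [cabs (_ - f w')]cabsB lerD // ltW.
Qed.

(** The preimage of an open set is the union of the cells it contains, taken over the partitions of
    tolerance $1/(m+1)$. *)
Lemma almost_discrete_borel_fun f : almost_discrete f -> borel_fun [set: Omega] f.
Proof.
move=> df.
have /choice[k kP] (m : nat) : exists k, measurable_fibers k /\
    forall w w', k w = k w' -> cabs (f w - f w') <= m.+1%:R^-1.
  by apply: df; rewrite invr_gt0.
apply: (@measurability _ _ _ (g_sigma_algebraType (@open C)) _ _ (@open C)) => // _ [U oU <-]; rewrite setTI.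
have -> : f @^-1` U = \bigcup_m \bigcup_(i in
    [set i | k m @^-1` [set i] `<=` f @^-1` U]) (k m @^-1` [set i]).
  apply/seteqP; split=> [w Uw|w [m _ [i /= iU iw]]]; last exact: iU.
  have [e e0 eU] := cplx_ball_nbhs oU Uw.
  have [m me] : exists m : nat, m.+1%:R^-1 < e.
    have [m _ hm] := near_infty_natSinv_lt (PosNum e0).
    by exists m; apply: (hm m) => /=.
  exists m => //; exists (k m w) => // w' /= kw'; apply: eU.
  by apply: le_lt_trans me; apply: (proj2 (kP m)).
apply: bigcup_measurable => m _; apply: bigcup_measurable => i _.
exact: (proj1 (kP m)).
Qed.

Lemma borel_fun_fibers (D : set Omega) k (c : nat -> C) : measurable D ->
  measurable_fibers k -> borel_fun D (fun w => c (k w)).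
Proof.
move=> mD mk _ Y _; apply: measurableI => //.
exact: (@measurable_fibers_preimage _ _ k (c @^-1` Y)).
Qed.

End borel_discretization.

(** * Approximate constancy of Blaschke cocycles *)

Section cocycle_discretization.
Context (R : realType) (d : measure_display) (Omega : measurableType d).
Local Notation C := (Cplx R).
Implicit Types (T : Omega -> C -> C) (z : C).

Lemma prod_dist_le n (u v : nat -> C) :
  (forall j, (j < n)%N -> cabs (u j) <= 1) -> (forall j, (j < n)%N -> cabs (v j) <= 1) ->
  cabs (\prod_(j < n) u j - \prod_(j < n) v j) <= \sum_(j < n) cabs (u j - v j).
Proof.
elim: n => [|n IH] u1 v1; first by rewrite !big_ord0 subrr cabs0.
rewrite !big_ord_recr /=; set U := \prod_(_ < n) u _; set V := \prod_(_ < n) v _.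
rewrite (_ : _ - _ = (U - V) * u n + V * (u n - v n)); last by ring.
apply: le_trans (cabsD _ _) _; rewrite !cabsM lerD //.
  apply: le_trans (IH _ _) => [|j jn|j jn]; last 2 first.
  - by apply: u1; exact: ltnW.
  - by apply: v1; exact: ltnW.
  by rewrite ler_piMr ?cabs_ge0 // u1.
rewrite ler_piMl ?cabs_ge0 // cabs_prod; apply: Num.Theory.prodr_ile1 => j _.
by rewrite cabs_ge0 v1 // ltnS ltnW.
Qed.

(** The difference is put over the single denominator $1-\bar az$, with the factor of b, of modulus
    at most 1, as a coefficient; thus only the distance of a to the circle enters. *)
Lemma blaschke_factor_dist (a b z : C) : cabs a < 1 -> cabs b < 1 -> cabs z <= 1 ->
  cabs ((z - a) / (1 - a^* * z) - (z - b) / (1 - b^* * z)) <=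
  2 * cabs (a - b) / (1 - cabs a).
Proof.
move=> a1 b1 z1; have da := subr1_conjM_neq0 a1 z1; have db := subr1_conjM_neq0 b1 z1.
rewrite (_ : _ - _ = ((b - a) + (z - b) / (1 - b^* * z) * ((a - b)^* * z)) /
  (1 - a^* * z)); last first.
  by rewrite rmorphB /=; field; rewrite da.
have a1' : 0 < 1 - cabs a by rewrite subr_gt0.
rewrite cabs_div ler_pM ?cabs_ge0 ?invr_ge0 ?cabs_ge0 //; last first.
  rewrite lef_pV2 ?posrE ?cabs_gt0 //.
  by apply: cabs_subr1_conjM_ge => //; exact: ltW.
apply: le_trans (cabsD _ _) _; rewrite [cabs (b - a)]cabsB mulr_natl mulr2n lerD2l.
rewrite [leRHS](_ : _ = 1 * (cabs (a - b) * 1)); last by rewrite mul1r mulr1.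
rewrite cabsM ler_pM ?cabs_ge0 //.
  rewrite cabs_div ler_pdivrMr ?mul1r ?cabs_gt0 //.
  by rewrite cabs_blaschke_factor_le // ltW.
by rewrite cabsM cabs_conj ler_pM ?cabs_ge0.
Qed.

Lemma blaschke_dist n (zeta zeta' : C) (a b : nat -> C) (e1 e2 : R) z :
  cabs zeta = 1 -> cabs zeta' = 1 -> cabs (zeta - zeta') <= e1 ->
  (forall j, (j < n)%N -> cabs (a j) < 1) -> (forall j, (j < n)%N -> cabs (b j) < 1) ->
  (forall j, (j < n)%N -> 2 * cabs (a j - b j) <= e2 * (1 - cabs (a j))) ->
  cabs z <= 1 ->
  cabs (blaschke n zeta a z - blaschke n zeta' b z) <= e1 + n%:R * e2.
Proof.
move=> z1 z1' ze a1 b1 ab zz; rewrite /blaschke.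
have fle (c : nat -> C) j : (forall j, (j < n)%N -> cabs (c j) < 1) -> (j < n)%N ->
    cabs ((z - c j) / (1 - (c j)^* * z)) <= 1.
  move=> c1 jn; rewrite cabs_div ler_pdivrMr ?mul1r.
    by rewrite cabs_blaschke_factor_le // ltW // c1.
  by rewrite cabs_gt0 subr1_conjM_neq0 // c1.
set A := \prod_(_ < _) _; set B := \prod_(_ < _) _.
have A1 : cabs A <= 1.
  rewrite cabs_prod; apply: Num.Theory.prodr_ile1 => j _.
  by rewrite cabs_ge0 fle.
rewrite (_ : _ - _ = (zeta - zeta') * A + zeta' * (A - B)); last by ring.
apply: le_trans (cabsD _ _) _; rewrite !cabsM z1' mul1r lerD //.
  by apply: le_trans ze; rewrite ler_piMr ?cabs_ge0.
apply: le_trans (prod_dist_le (fun j jn => fle a j a1 jn) (fun j jn => fle b j b1 jn)) _.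
apply: le_trans (_ : \sum_(j < n) e2 <= _); last first.
  by rewrite sumr_const card_ord mulr_natl.
apply: ler_sum => j _; apply: le_trans (blaschke_factor_dist _ _ zz) _; rewrite ?a1 ?b1 //.
by rewrite ler_pdivrMr ?subr_gt0 ?a1 // ab.
Qed.

(* The tolerance on the zeros is scaled by 1 - |q|, as a Blaschke factor is
   sensitive to the hyperbolic position of its zero. *)
Lemma blaschke_cocycle_almost_discrete T : blaschke_cocycle T ->
  forall eta : R, 0 < eta -> constant_on_fibers (fun w w' =>
    forall z, cabs z <= 1 -> cabs (T w z - T w' z) <= eta).
Proof.
move=> [n [zeta [a [mn bzeta ba adm TE]]]] eta eta0.
(* The bound 1/2 gives $1-|q|\le2(1-|a|)$ for a zero a approximated by q, so that [blaschke_dist]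
   applies with [e2] equal to [8 * s N]. The N zeros then cost at most [eta / 2], and zeta the other
   half. *)
pose s (N : nat) : R := Num.min 2^-1 (eta / (16 * N.+1%:R)).
have s0 N : 0 < s N.
  by rewrite lt_min invr_gt0 ltr0n /= divr_gt0 // mulr_gt0 // ltr0n.
have s2 N : s N <= 2^-1 by rewrite ge_min lexx.
have sN (N : nat) : 8 * N%:R * s N <= eta / 2.
  have : s N <= eta / (16 * N.+1%:R) by rewrite ge_min lexx orbT.
  have N0 : 0 < N.+1%:R :> R by rewrite ltr0n.
  rewrite ler_pdivlMr ?mulr_gt0 // => h.
  have : N%:R * s N <= N.+1%:R * s N.
    by rewrite ler_wpM2r ?(ltW (s0 N)) // ler_nat.
  by lra.
pose q := @cplx_rat R.
(* The index records the degree and rational approximations of zeta and of the zeros, the latter in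
   a finite list, which keeps the index set countable. *)
pose E (i : nat * (rat * rat) * seq (rat * rat)) :=
  [set w | n w = i.1.1] `&` [set w | cabs (zeta w - q i.1.2) < eta / 4] `&`
  \bigcap_(j in [set j | (j < i.1.1)%N]) ([set w | n w = i.1.1] `&`
    ([set w | (j < n w)%N] `&`
     [set w | cabs (a j w - q (nth (0, 0) i.2 j)) <
       s i.1.1 * (1 - cabs (q (nth (0, 0) i.2 j)))])).
have mnE N : measurable [set w | n w = N].
  by rewrite -[X in measurable X]setTI; exact: (mn measurableT [set N]).
have mD j : measurable [set w | (j < n w)%N].
  by rewrite -[X in measurable X]setTI; exact: (mn measurableT [set m | (j < m)%N]).
have mE i : measurable (E i).
  apply: measurableI.
    apply: measurableI => //.
    by rewrite -[X in measurable X]setTI; exact: borel_fun_ball.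
  apply: bigcap_measurableType => j _; apply: measurableI => //.
  exact: borel_fun_ball.
have cE w : exists i, E i w.
  have [n1 zeta1 a1] := adm w.
  have [u hu] := @cplx_rat_dense R (zeta w) (eta / 4) (divr_gt0 eta0 (ltr0n _ 4)).
  have /choice[p hp] (j : nat) : exists p, (j < n w)%N ->
      cabs (a j w - q p) < s (n w) * (1 - cabs (q p)).
    have [jn|] := boolP (j < n w)%N; last by exists (0, 0).
    have a1' : 0 < 1 - cabs (a j w) by rewrite subr_gt0 a1.
    have [p hp] := @cplx_rat_dense R (a j w) (s (n w) * (1 - cabs (a j w)) / 2)
      (divr_gt0 (mulr_gt0 (s0 _) a1') (ltr0n _ 2)).
    exists p => _; apply: (lt_le_trans hp); rewrite -mulrA ler_wpM2l ?(ltW (s0 _)) //.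
    have : cabs (q p) <= cabs (a j w) + (1 - cabs (a j w)) / 2.
      rewrite addrC -lerBlDr; apply: le_trans (cabsB_ge _ _) _; rewrite cabsB.
      apply: (le_trans (ltW hp)); rewrite -mulrA ler_piMl ?divr_ge0 ?(ltW a1') //.
      by apply: le_trans (s2 _) _; lra.
    by lra.
  exists (n w, u, mkseq p (n w)); split=> //= j /= jn; split=> //; split=> //=.
  by rewrite nth_mkseq // hp.
apply: constant_on_fibers_imp (constant_on_fibers_cover mE cE).
move=> w w' [[[N u] t] [[[/= nw zw] aw] [[/= nw' zw'] aw']]] z z1.
have [_ zeta1 a1] := adm w; have [_ zeta1' a1'] := adm w'.
rewrite !TE nw nw'.
apply: le_trans (_ : eta / 2 + N%:R * (8 * s N) <= _); last first.
  by have := sN N; rewrite mulrCA mulrA; lra.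
apply: blaschke_dist => //.
- apply: le_trans (cabs_dist_triangle _ (q u) _) _; rewrite [cabs (q u - _)]cabsB.
  by move: zw zw'; lra.
- by move=> j jN; apply: a1; rewrite nw.
- by move=> j jN; apply: a1'; rewrite nw'.
move=> j jN.
have [_ [_ /=]] := aw j jN; have [_ [_ /=]] := aw' j jN.
set p := q _; move=> h' h.
have := cabs_dist_triangle (a j w) p (a j w'); rewrite [cabs (p - _)]cabsB => tri.
have := cabsB_ge (a j w) p => ap.
have p1 : 0 <= 1 - cabs p.
  have : 0 <= s N * (1 - cabs p) by exact: le_trans (cabs_ge0 _) (ltW h).
  by rewrite pmulr_rge0.
have k2 : s N * (1 - cabs p) <= 2^-1 * (1 - cabs p) by rewrite ler_wpM2r.
have : s N * ((1 - cabs p) / 2) <= s N * (1 - cabs (a j w)).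
  by rewrite ler_wpM2l ?(ltW (s0 N)) //; move: h k2 ap; lra.
by move: tri h h'; lra.
Qed.

Lemma blaschke_lipschitz n (f : C -> C) (r : R) (x z : C) : r < 1 -> is_blaschke n f ->
  cabs x <= r -> cabs z <= 1 -> cabs (f z - f x) <= 2 / (1 - r) * cabs (z - x).
Proof.
move=> r1 bf xr z1.
have := @rat_lipschitz R 1 r f x 1 ltr01 r1 xr (is_blaschke_rat_on bf)
  (fun y => @is_blaschke_le1 R n f y bf) z z1.
by rewrite mulr1.
Qed.

Lemma blaschke_cocycle_is_blaschke T w : blaschke_cocycle T ->
  exists n, (1 <= n)%N /\ is_blaschke n (T w).
Proof.
move=> [n [zeta [a [_ _ _ adm TE]]]]; have [n1 zeta1 a1] := adm w.
exists (n w); split=> //; exists (zeta w), (a ^~ w); split=> //.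
Qed.

(** The partition for T is uniform on the disc, so a moving argument costs only one Lipschitz
    estimate. *)
Lemma blaschke_cocycle_eval T (x : Omega -> C) (r : R) : r < 1 -> blaschke_cocycle T ->
  almost_discrete x -> (forall w, cabs (x w) <= r) ->
  almost_discrete (fun w => T w (x w)).
Proof.
move=> r1 bT dx xr eta eta0.
have r1' : 0 < 1 - r by rewrite subr_gt0.
have e0 : 0 < eta / 2 * ((1 - r) / 2) by rewrite mulr_gt0 ?divr_gt0.
apply: constant_on_fibers_imp (constant_on_fibers_and
  (blaschke_cocycle_almost_discrete bT (divr_gt0 eta0 (ltr0n _ 2))) (dx _ e0)).
move=> w w' [TT xx]; have x1 v : cabs (x v) <= 1 := le_trans (xr v) (ltW r1).
apply: le_trans (cabs_dist_triangle _ (T w' (x w)) _) _.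
rewrite [leRHS](splitr eta) lerD ?TT //.
have [n [_ bn]] := blaschke_cocycle_is_blaschke w' bT.
apply: le_trans (blaschke_lipschitz r1 bn (xr _) (x1 _)) _.
rewrite mulrC; apply: le_trans (ler_wpM2r _ xx) _; first by rewrite divr_ge0 ?(ltW r1').
by rewrite le_eqVlt; apply/orP; left; apply/eqP; field; rewrite gt_eqF.
Qed.

End cocycle_discretization.

(** * Limits of sequences with geometric increments *)

Section geometric_limits.
Context (R : realType).
Local Notation C := (Cplx R).

Lemma le_of_geometric_error (a b c q : R) : 0 <= q < 1 ->
  (forall k : nat, a <= b + c * q ^+ k) -> a <= b.
Proof.
move=> /andP[q0 q1] h.
have qk : (fun k => q ^+ k) @ \oo --> (0 : R).
  by apply: cvg_expr; rewrite ger0_norm.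
have l1 : (fun=> a) @ \oo --> a by exact: cvg_cst.
have l2 : (fun k => b + c * q ^+ k) @ \oo --> b + c * 0.
  by apply: cvgD; [exact: cvg_cst|apply: cvgMr].
by have := ler_cvg_to l1 l2 (nearW _ h); rewrite mulr0 addr0; apply.
Qed.

(** Nested intervals: with $e_k=Aq^k/(1-q)$, the tail of the series, $u_k-e_k$ increases and
    $u_k+e_k$ decreases; y is the supremum of the lower ends. *)
Lemma geometric_limit_real (u : nat -> R) (A q : R) : 0 <= q < 1 ->
  (forall k, `|u k.+1 - u k| <= A * q ^+ k) ->
  exists y, forall k, `|y - u k| <= A / (1 - q) * q ^+ k.
Proof.
move=> /andP[q0 q1] du; have q1' : 0 < 1 - q by rewrite subr_gt0.
pose e k := A / (1 - q) * q ^+ k.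
have eE k : e k - e k.+1 = A * q ^+ k.
  by rewrite /e exprS; field; rewrite gt_eqF.
have lo : {homo (fun k => u k - e k) : i j / (i <= j)%N >-> i <= j}.
  apply: homo_leq; [exact: lexx|by move=> y x z; exact: le_trans|move=> k].
  by have := du k; rewrite ler_norml -eE => /andP[h _]; lra.
have hi : {homo (fun k => u k + e k) : i j / (i <= j)%N >-> j <= i}.
  apply: (@homo_leq _ _ (fun x y => y <= x)); [exact: lexx| |move=> k].
    by move=> y x z yx zy; exact: le_trans zy yx.
  by have := du k; rewrite ler_norml -eE => /andP[_ h]; lra.
have e0 k : 0 <= e k.
  rewrite mulr_ge0 ?exprn_ge0 // divr_ge0 ?(ltW q1') //.
  by have := le_trans (normr_ge0 _) (du 0); rewrite expr0 mulr1.
have lohi i j : u i - e i <= u j + e j.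
  apply: le_trans (lo i (maxn i j) (leq_maxl _ _)) _.
  apply: le_trans (hi j (maxn i j) (leq_maxr _ _)).
  by have := e0 (maxn i j); rewrite /=; lra.
exists (sup (range (fun k => u k - e k))) => k.
rewrite ler_distl; apply/andP; split.
  apply: ub_le_sup; last by exists k.
  by exists (u 0 + e 0) => _ [i _ <-].
apply: ge_sup; first by exists (u 0 - e 0); exists 0%N.
by move=> _ [i _ <-].
Qed.

Lemma geometric_limit (u : nat -> C) (A q : R) : 0 <= q < 1 ->
  (forall k, cabs (u k.+1 - u k) <= A * q ^+ k) ->
  exists y, forall k, cabs (y - u k) <= 2 * A / (1 - q) * q ^+ k.
Proof.
move=> q01 du.
have ReB (z w : C) : complex.Re (z - w) = complex.Re z - complex.Re w.
  by case: z w => ? ? [].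
have ImB (z w : C) : complex.Im (z - w) = complex.Im z - complex.Im w.
  by case: z w => ? ? [].
have [|a ha] := @geometric_limit_real (fun k => complex.Re (u k)) A q q01.
  by move=> k; rewrite -ReB (le_trans (cabs_Re _)).
have [|b hb] := @geometric_limit_real (fun k => complex.Im (u k)) A q q01.
  by move=> k; rewrite -ImB (le_trans (cabs_Im _)).
exists (Complex a b) => k; apply: le_trans (cabs_le_ReIm _) _.
rewrite ReB ImB /=; apply: le_trans (lerD (ha k) (hb k)) _.
by rewrite le_eqVlt; apply/orP; left; apply/eqP; ring.
Qed.

End geometric_limits.

(** * Invariant sets of full measure *)

Section invariant_sets.
Context (R : realType) (d : measure_display) (Omega : measurableType d).
Variables (P : probability Omega R) (sigma tau : Omega -> Omega).
Hypotheses (msigma : measurable_fun [set: Omega] sigma)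
  (mtau : measurable_fun [set: Omega] tau)
  (st : cancel sigma tau) (ts : cancel tau sigma).
Hypothesis Psigma : measure_preserving P sigma.

(** All preimages of the exceptional null set under iterates of sigma and tau are discarded, a
    countable union of null sets. An a.e. property then holds along whole orbits, as the pullback
    iteration requires. *)
Lemma ae_invariant_subset (Q : Omega -> Prop) : {ae P, forall w, Q w} ->
  exists G : set Omega, [/\ measurable G, {ae P, forall w, G w},
    forall w, G w -> Q w, forall w, G w -> G (sigma w) &
    forall w, G w -> G (tau w)].
Proof.
move=> [N [mN PN QN]].
have mi (f : Omega -> Omega) k : measurable_fun [set: Omega] f ->
    measurable (iter k f @^-1` N).
  move=> mf; elim: k => //= k IH.
  rewrite (_ : _ @^-1` _ = f @^-1` (iter k f @^-1` N)).
    by rewrite -[X in measurable X]setTI; exact: mf.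
  by apply/seteqP; split=> w /=; rewrite -iterSr.
have Psig A : measurable A -> P (sigma @^-1` A) = P A := proj2 Psigma A.
have Ptau A : measurable A -> P (tau @^-1` A) = P A.
  move=> mA; rewrite -Psig; last by rewrite -[X in measurable X]setTI; exact: mtau.
  by congr (P _); apply/seteqP; split=> w /=; rewrite st.
have Pi (f : Omega -> Omega) k : measurable_fun [set: Omega] f ->
    (forall A, measurable A -> P (f @^-1` A) = P A) -> P (iter k f @^-1` N) = 0%E.
  move=> mf Pf; elim: k => //= k IH.
  rewrite (_ : _ @^-1` _ = f @^-1` (iter k f @^-1` N)) ?Pf //; first exact: mi.
  by apply/seteqP; split=> w /=; rewrite -iterSr.
pose G := (\bigcap_k (~` (iter k sigma @^-1` N))) `&`
          (\bigcap_k (~` (iter k tau @^-1` N))).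
exists G; split.
- by apply: measurableI; apply: bigcapT_measurable => k; apply: measurableC; exact: mi.
- suff : P.-negligible (~` G) by [].
  rewrite /G setCI !setC_bigcap.
  under eq_bigcupr do rewrite setCK.
  under [X in _ `|` X]eq_bigcupr do rewrite setCK.
  apply: negligibleU; apply: negligible_bigcup => k.
    by exists (iter k sigma @^-1` N); split=> //; [exact: mi|exact: Pi].
  by exists (iter k tau @^-1` N); split=> //; [exact: mi|exact: Pi].
- move=> w [h _]; apply: contrapT => nQ.
  by have := h 0%N I => /=; apply; apply: QN.
- move=> w [h1 h2]; split=> k _ /=.
    by rewrite -iterSr; exact: (h1 k.+1 I).
  case: k => [|k]; first exact: (h1 1%N I).
  by rewrite iterSr st; exact: (h2 k I).
- move=> w [h1 h2]; split=> k _ /=; last first.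
    by rewrite -iterSr; exact: (h2 k.+1 I).
  case: k => [|k]; first exact: (h2 1%N I).
  by rewrite iterSr ts; exact: (h1 k I).
Qed.

End invariant_sets.

(** * Closure properties of almost discrete functions *)

Section almost_discrete_closure.
Context (R : realType) (d : measure_display) (Omega : measurableType d).
Local Notation C := (Cplx R).

Lemma almost_discrete_cst (c : C) : almost_discrete (fun _ : Omega => c).
Proof.
move=> eta eta0; exists (fun=> 0%N); split=> [i|w w' _].
  by rewrite preimage_cst; case: ifP.
by rewrite subrr cabs0 ltW.
Qed.

Lemma almost_discrete_patch (G : set Omega) (f : Omega -> C) : measurable G ->
  almost_discrete f -> almost_discrete (fun w => if `[< G w >] then f w else 0).
Proof.
move=> mG df eta eta0.
apply: constant_on_fibers_imp
  (constant_on_fibers_and (constant_on_fibers_set mG) (df _ eta0)).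
move=> w w' [GG ff]; case: asboolP => Gw; case: asboolP => Gw' //.
- by exfalso; apply: Gw'; apply/GG.
- by exfalso; apply: Gw; apply/GG.
- by rewrite subrr cabs0 ltW.
Qed.

Lemma almost_discrete_comp (t : Omega -> Omega) (f : Omega -> C) :
  measurable_fun [set: Omega] t -> almost_discrete f ->
  almost_discrete (fun w => f (t w)).
Proof.
by move=> mt df eta eta0; exact: (constant_on_fibers_comp mt (df _ eta0)).
Qed.

Lemma almost_discrete_uniform_limit (f : Omega -> C) :
  (forall eta : R, 0 < eta -> exists2 g, almost_discrete g &
     forall w, cabs (f w - g w) <= eta) ->
  almost_discrete f.
Proof.
move=> fg eta eta0; have e0 : 0 < eta / 3 by rewrite divr_gt0.
have [g dg fgE] := fg _ e0.
apply: constant_on_fibers_imp (dg _ e0) => w w' gg.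
apply: le_trans (cabs_dist_triangle _ (g w) _) _.
apply: le_trans (lerD (fgE w) (cabs_dist_triangle _ (g w') _)) _.
by have := fgE w'; rewrite [cabs (f w' - _)]cabsB; move: gg; lra.
Qed.

End almost_discrete_closure.

(** * Random fixed points near approximate ones *)

Section random_fixed_points.
Context (R : realType) (d : measure_display) (Omega : measurableType d).
Variables (P : probability Omega R) (sigma tau : Omega -> Omega) (rho : R).
Hypotheses (msigma : measurable_fun [set: Omega] sigma)
  (mtau : measurable_fun [set: Omega] tau)
  (st : cancel sigma tau) (ts : cancel tau sigma).
Hypothesis Psigma : measure_preserving P sigma.
Hypotheses (rho0 : 0 < rho) (rho1 : rho < 1).
Local Notation C := (Cplx R).
Implicit Types (T : Omega -> C -> C) (x : Omega -> C).

Lemma cocycle_radius_real T (r : R) : (cocycle_radius P T rho < r%:E)%E ->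
  exists rT : R, [/\ cocycle_radius P T rho = rT%:E, 0 <= rT, rT < r &
    {ae P, forall w, forall z, cabs z = rho -> cabs (T w z) <= rT}].
Proof.
move=> Tr.
have c0 w : (0 <= circle_max (T w) rho)%E.
  apply: (@le_trans _ _ (cabs (T w rho%:C%C))%:E); first by rewrite lee_fin cabs_ge0.
  by apply: ereal_sup_ubound; exists rho%:C%C => //=; rewrite circle_point ?ltW.
have T0 : (0 <= cocycle_radius P T rho)%E.
  (* A lower bound on an essential supremum needs a space of positive mass. *)
  apply: ess_sup_gee; last exact: nearW.
  by have := probability_setT P => /= ->; exact: lte01.
have fin : cocycle_radius P T rho \is a fin_num.
  by rewrite ge0_fin_numE // (lt_trans Tr) ?ltry.
exists (fine (cocycle_radius P T rho)); rewrite fineK //; split=> //.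
- by rewrite fine_ge0.
- by rewrite -lte_fin fineK.
have := ess_sup_ge P (fun w => circle_max (T w) rho).
apply: filterS => w h z zr; rewrite -lee_fin fineK //; apply: le_trans h.
by apply: ereal_sup_ubound; exists z.
Qed.

(* y is the limit of the pullback iteration X_{N+1}(w) = T(X_N(tau w)) started
   at the approximate fixed point x. *)
Lemma random_fixed_point_near (r : R) : 0 < r -> r < rho ->
  exists2 K, 0 < K & forall T x (eta : R), blaschke_cocycle T ->
    (cocycle_radius P T rho < r%:E)%E -> almost_discrete x ->
    (forall w, cabs (x w) <= r) -> 0 <= eta ->
    {ae P, forall w, cabs (T w (x w) - x (sigma w)) <= eta} ->
    exists y, [/\ random_fixed_point P sigma rho T y, forall w, cabs (y w) <= r &
      {ae P, forall w, cabs (y w - x w) <= K * eta}].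
Proof.
move=> r0 rr.
pose q := pdist_rate rho r; have q01 : 0 <= q < 1 := pdist_rate_bounds r0 rr.
have /andP[q0 q1] := q01; have q1' : 0 < 1 - q by rewrite subr_gt0.
have d0 : 0 < rho ^+ 2 - r ^+ 2.
  by rewrite subr_gt0 ltr_pXn2r ?nnegrE ?(ltW r0) ?(ltW rho0).
pose k0 := rho / (rho ^+ 2 - r ^+ 2).
have k00 : 0 < k0 by rewrite divr_gt0.
(* [k0] turns the initial error into pseudo-hyperbolic distance, [2 * rho] turns it back, $1/(1-q)$
   sums the series, and the outer 2 comes from the real and imaginary parts in [geometric_limit]. *)
pose K := 2 * (2 * rho * k0) / (1 - q).
exists K.
  by apply: divr_gt0 => //; apply: mulr_gt0 => //; apply: mulr_gt0 => //; exact: mulr_gt0.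
move=> T x eta bT Tr dx xr eta0 Tx.
have [rT [rTE rT0 rTr Trho]] := cocycle_radius_real Tr.
have [G [mG Gae GQ Gs Gt]] :=
  ae_invariant_subset msigma mtau st ts Psigma (filterI Trho Tx).
have Tdisc w z : G w -> cabs z <= rho -> cabs (T w z) <= rT.
  move=> Gw zr; have [n [_ bn]] := blaschke_cocycle_is_blaschke w bT.
  apply: (rat_maximum_principle rho0 _ _ zr); last exact: (proj1 (GQ w Gw)).
  exact: rat_on_le (ltW rho1) (is_blaschke_rat_on bn).
(* The value 0 off G makes the bounds hold at every w, as [random_fixed_point] demands, and not only
   almost everywhere. *)
pose X := fix X (N : nat) (w : Omega) : C :=
  if `[< G w >] then (if N is M.+1 then T (tau w) (X M (tau w)) else x w) else 0.
have X0 w : G w -> X 0%N w = x w by move=> Gw /=; rewrite asboolT.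
have XS N w : G w -> X N.+1 w = T (tau w) (X N (tau w)).
  by move=> Gw /=; rewrite asboolT.
have XN N w : ~ G w -> X N w = 0 by move=> nG; case: N => [|N] /=; rewrite asboolF.
have Xr N w : cabs (X N w) <= r.
  have [Gw|nG] := pselect (G w); last by rewrite XN // cabs0 ltW.
  elim: N w Gw => [|N IH] w Gw; first by rewrite X0.
  rewrite XS // (le_trans _ (ltW rTr)) // Tdisc ?(le_trans (IH _ _)) ?ltW //; exact: Gt.
have dX N : almost_discrete (X N).
  elim: N => [|N IH]; first exact: almost_discrete_patch.
  apply: almost_discrete_patch => //.
  apply: (almost_discrete_comp (f := fun w => T w (X N w)) mtau).
  by apply: (@blaschke_cocycle_eval _ _ _ T (X N) r) => //; exact: lt_trans rho1.
have rrho v N : cabs (X N v) < rho by exact: le_lt_trans (Xr _ _) rr.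
have Xp N w : G w -> pdist rho (X N.+1 w) (X N w) <= k0 * eta * q ^+ N.
  elim: N w => [|N IH] w Gw.
    rewrite expr0 mulr1 (XS _ _ Gw) (X0 _ Gw) (X0 _ (Gt _ Gw)).
    have Tt := GQ _ (Gt _ Gw); apply: le_trans (pdist_le (ltW r0) rr _ _) _ => //.
      by rewrite (le_trans _ (ltW rTr)) // Tdisc ?(le_trans (xr _)) ?ltW //; exact: Gt.
    rewrite ler_wpM2l ?(ltW k00) //.
    by have := proj2 Tt; rewrite ts.
  rewrite (XS N.+1 _ Gw) (XS N _ Gw).
  have [n [_ bn]] := blaschke_cocycle_is_blaschke (tau w) bT.
  apply: le_trans (pdist_contraction r0 rr
    (rat_on_le (ltW rho1) (is_blaschke_rat_on bn)) _ (rrho _ _) (rrho _ _)) _.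
    by move=> z zr; apply: le_lt_trans rTr; apply: Tdisc => //; exact: Gt.
  by rewrite exprS [leRHS]mulrCA; apply: ler_wpM2l => //; apply: IH; exact: Gt.
have Xd N w : cabs (X N.+1 w - X N w) <= 2 * rho * (k0 * eta) * q ^+ N.
  have [Gw|nG] := pselect (G w); last first.
    rewrite !XN // subrr cabs0; apply: mulr_ge0; last exact: exprn_ge0.
    apply: mulr_ge0; last exact: mulr_ge0 (ltW k00) eta0.
    by rewrite mulr_ge0 ?(ltW rho0).
  apply: le_trans (cabs_le_pdist rho0 (rrho _ _) (rrho _ _)) _.
  rewrite -[leRHS]mulrA; apply: ler_wpM2l; last exact: Xp.
  by rewrite mulr_ge0 ?(ltW rho0).
have /choice[y yX] w := geometric_limit q01 (Xd ^~ w).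
have {}yX w N : cabs (y w - X N w) <= K * eta * q ^+ N.
  apply: le_trans (yX w N) _; rewrite le_eqVlt; apply/orP; left; apply/eqP.
  by rewrite /K; field; rewrite gt_eqF.
have yr w : cabs (y w) <= r.
  apply: (@le_of_geometric_error _ _ _ (K * eta) q) => // N.
  rewrite -lerBlDl; apply: le_trans (yX w N).
  by apply: le_trans (cabsB_ge _ _); rewrite lerD2l lerN2.
have yN w : ~ G w -> y w = 0.
  move=> nG; apply/eqP; rewrite -cabs_eq0 eq_le cabs_ge0 andbT.
  apply: (@le_of_geometric_error _ _ _ (K * eta) q) => // N.
  by rewrite add0r; have := yX w N; rewrite XN // subr0.
have r1 : r < 1 by exact: lt_trans rho1.
(* Both sides are within $O(q^N)$ of $T_w(X_N(w))=X_{N+1}(\sigma w)$. *)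
have yT w : G w -> T w (y w) = y (sigma w).
  move=> Gw; apply/eqP; rewrite -subr_eq0 -cabs_eq0 eq_le cabs_ge0 andbT.
  pose L := 2 / (1 - r); have L0 : 0 <= L by rewrite divr_ge0 ?subr_ge0 ?ltW.
  apply: (@le_of_geometric_error _ _ _ (L * (K * eta) + K * eta) q) => // N.
  rewrite add0r mulrDl; have [n [_ bn]] := blaschke_cocycle_is_blaschke w bT.
  apply: le_trans (cabs_dist_triangle _ (T w (X N w)) _) _; apply: lerD.
    apply: le_trans (blaschke_lipschitz r1 bn (Xr _ _) (le_trans (yr _) (ltW r1))) _.
    by rewrite -[leRHS]mulrA; apply: ler_wpM2l.
  have -> : T w (X N w) = X N.+1 (sigma w) by rewrite XS ?st //; exact: Gs.
  rewrite cabsB; apply: le_trans (yX _ _) _; rewrite exprSr mulrA ler_piMr ?(ltW q1) //.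
  by apply: le_trans (yX w N); exact: cabs_ge0.
exists y; split=> //; last first.
  by apply: filterS Gae => w Gw; have := yX w 0%N; rewrite X0 // expr0 mulr1.
split=> [|w|].
- apply/almost_discrete_borel_fun/almost_discrete_uniform_limit => e e0.
  have qk : (fun k => K * eta * q ^+ k) @ \oo --> K * eta * (0 : R).
    by apply: cvgMr; apply: cvg_expr; rewrite ger0_norm.
  have : \forall k \near \oo, K * eta * q ^+ k < e.
    by apply: (cvgr_lt _ qk); rewrite mulr0.
  move=> [N _ /(_ N (leqnn N)) /= qN].
  by exists (X N) => // w; apply: le_trans (yX w N) (ltW qN).
(* On G, y is a value of T at the previous point of the orbit, which sharpens the bound r to the
   radius of the cocycle. *)
- rewrite rTE lee_fin; have [Gw|nG] := pselect (G w); last by rewrite yN // cabs0.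
  rewrite -(ts w) -yT; last exact: Gt.
  by apply: Tdisc; [exact: Gt|exact: le_trans (yr _) (ltW rr)].
- by apply: filterS Gae => w Gw; exact: yT.
Qed.

(** The constant 0 is an approximate fixed point with error 1, since Blaschke products are bounded
    by 1. *)
Lemma random_fixed_point_exists T (r : R) : 0 < r -> r < rho ->
  blaschke_cocycle T -> (cocycle_radius P T rho < r%:E)%E ->
  exists x, random_fixed_point P sigma rho T x /\ forall w, cabs (x w) <= r.
Proof.
move=> r0 rr bT Tr; have [K _ fp] := random_fixed_point_near r0 rr.
have zr (w : Omega) : cabs (0 : C) <= r by rewrite cabs0 ltW.
have T1 : {ae P, forall w, cabs (T w 0 - 0) <= 1}.
  apply: nearW => w; rewrite subr0.
  have [n [_ bn]] := blaschke_cocycle_is_blaschke w bT.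
  by apply: is_blaschke_le1 bn _; rewrite cabs0.
have [x [? ? _]] := fp T (fun=> 0) 1 bT Tr (almost_discrete_cst _ 0) zr ler01 T1.
by exists x.
Qed.

End random_fixed_points.

(** * Derivative estimates uniform in the degree *)

Section blaschke_derivatives.
Context (R : realType).
Local Notation C := (Cplx R).

Lemma blaschke_derive1_lipschitz n (f : C -> C) (r : R) (x z : C) : r < 1 ->
  is_blaschke n f -> cabs x <= r -> cabs z <= r ->
  cabs (derive1 f z - derive1 f x) <= 8 / (1 - r) ^+ 2 * cabs (z - x).
Proof.
move=> r1 bf xr zr.
have := @derive1_lipschitz R 1 r f x z 1 ltr01 r1 xr zr (is_blaschke_rat_on bf)
  (fun y => @is_blaschke_le1 R n f y bf).
by rewrite mulr1.
Qed.

Lemma blaschke_derive1_dist n m (f g : C -> C) (r e : R) (x : C) : r < 1 ->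
  is_blaschke n f -> is_blaschke m g -> cabs x <= r ->
  (forall z, cabs z <= 1 -> cabs (f z - g z) <= e) ->
  cabs (derive1 f x - derive1 g x) <= 2 * e / (1 - r).
Proof.
move=> r1 bf bg xr fge.
have rf := is_blaschke_rat_on bf; have rg := is_blaschke_rat_on bg.
rewrite -(derive1_rat_sub (le_lt_trans xr r1) rf rg).
exact: (proj1 (rat_taylor ltr01 r1 xr (rat_onB rf rg) fge)).
Qed.

End blaschke_derivatives.

(** * Openness and density of the stable cocycles *)

Section stable_cocycles.
Context (R : realType) (d : measure_display) (Omega : measurableType d).
Variables (P : probability Omega R) (sigma tau : Omega -> Omega) (rho : R).
Hypotheses (msigma : measurable_fun [set: Omega] sigma)
  (mtau : measurable_fun [set: Omega] tau)
  (st : cancel sigma tau) (ts : cancel tau sigma).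
Hypothesis Psigma : measure_preserving P sigma.
Hypotheses (rho0 : 0 < rho) (rho1 : rho < 1).
Local Notation C := (Cplx R).
Local Notation stable := (@stable R d Omega P sigma rho).

Lemma cocycle_dist_ae (T S : Omega -> C -> C) (e : R) :
  (cocycle_dist P T S <= e%:E)%E <->
  {ae P, forall w, forall z, cabs z <= 1 -> cabs (T w z - S w z) <= e}.
Proof.
split=> [/ess_supP|h].
  apply: filterS => w h z z1; rewrite -lee_fin; apply: le_trans h.
  by apply: ereal_sup_ubound; exists z.
apply/ess_supP; apply: filterS h => w h.
by apply: ge_ereal_sup => _ [z z1 <-]; rewrite lee_fin h.
Qed.

Lemma cocycle_radius_close (T S : Omega -> C -> C) (rT e : R) :
  {ae P, forall w, forall z, cabs z = rho -> cabs (T w z) <= rT} ->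
  {ae P, forall w, forall z, cabs z <= 1 -> cabs (T w z - S w z) <= e} ->
  (cocycle_radius P S rho <= (rT + e)%:E)%E.
Proof.
move=> hT hS; apply/ess_supP; apply: filterS2 hT hS => w hT hS.
apply: ge_ereal_sup => _ [z /= zr <-]; rewrite lee_fin.
rewrite -(subrK (T w z) (S w z)) addrC; apply: le_trans (cabsD _ _) _.
by rewrite lerD ?hT // cabsB hS // zr ltW.
Qed.

Let half_bound (dl a b t : R) : dl <= a -> a - b <= t -> t <= dl / 2 -> dl / 2 <= b.
Proof. by lra. Qed.

(** Common core of openness and density: stability is tested at an approximate fixed point. The true
    one is so close that, by the Lipschitz bound on derivatives included in K, at most half of [dl]
    is lost. *)
Lemma stable_of_near_fixed_point (r : R) : 0 < r -> r < rho ->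
  exists2 K, 0 < K & forall (S : blaschkeSpace P rho) x (eta dl : R),
    (cocycle_radius P S rho < r%:E)%E -> almost_discrete x ->
    (forall w, cabs (x w) <= r) -> 0 <= eta ->
    {ae P, forall w, cabs (S w (x w) - x (sigma w)) <= eta} ->
    0 < dl -> {ae P, forall w, dl <= cabs (derive1 (S w) (x w))} ->
    K * eta <= dl / 2 -> stable S.
Proof.
move=> r0 rr; have r1 : r < 1 by exact: lt_trans rho1.
have r1' : 0 < (1 - r) ^+ 2 by rewrite exprn_gt0 // subr_gt0.
have [K K0 fp] := random_fixed_point_near msigma mtau st ts Psigma rho0 rho1 r0 rr.
exists (8 / (1 - r) ^+ 2 * K); first by apply: mulr_gt0 => //; exact: divr_gt0.
move=> S x eta dl Sr dx xr eta0 Sx dl0 Sdl Kdl.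
have bS := cocycle_blaschke S.
have [y [fy yr yx]] := fp S x eta bS Sr dx xr eta0 Sx.
exists y; split=> //; apply: (@lt_le_trans _ _ (dl / 2)%:E).
  by rewrite lte_fin divr_gt0.
apply/ess_infP; apply: filterS2 Sdl yx => w Sdl yx; rewrite lee_fin.
have [n [_ bn]] := blaschke_cocycle_is_blaschke w bS.
have := blaschke_derive1_lipschitz r1 bn (yr w) (xr w).
have c0 : 0 <= 8 / (1 - r) ^+ 2 by rewrite divr_ge0 // ltW.
have := ler_wpM2l c0 yx; rewrite mulrA [cabs (x w - _)]cabsB => h1 h2.
exact: half_bound Sdl (cabsB_ge _ _) (le_trans h2 (le_trans h1 Kdl)).
Qed.

Lemma open_stable : open stable.
Proof.
rewrite openE => T [x [fx xinf]].
have [rT [rTE rT0 rTrho Trho]] := cocycle_radius_real rho0 (cocycle_radius_lt T).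
(* Room on both sides: nearby cocycles still have radius below r, and r below rho gives them a
   common contraction rate. *)
pose r := (rT + rho) / 2.
have rTr : rT < r by rewrite /r; lra.
have rr : r < rho by rewrite /r; lra.
have r0 : 0 < r by exact: le_lt_trans rTr.
have r1 : r < 1 by exact: lt_trans rho1.
have r1' : 0 < 1 - r by rewrite subr_gt0.
have [bx xrT Tx] := fx.
have xr w : cabs (x w) <= r.
  by have := xrT w; rewrite rTE lee_fin => h; apply: (le_trans h); exact: ltW.
have [dl dl0 Tdl] : exists2 dl : R, 0 < dl &
    {ae P, forall w, dl <= cabs (derive1 (T w) (x w))}.
  have ae_inf := ess_inf_le P (fun w => (cabs (derive1 (T w) (x w)))%:E).
  move: xinf ae_inf; case: (ess_inf _ _) => [c| |] // c0 ae_inf.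
    exists c; first by rewrite -lte_fin.
    by apply: filterS ae_inf => w; rewrite lee_fin.
  by exists 1 => //; apply: filterS ae_inf => w; rewrite leye_eq.
have [K K0 stab] := stable_of_near_fixed_point r0 rr.
(* The three bounds keep the radius of S below r, the derivative of S at x above [dl / 2], and the
   loss in passing to the fixed point of S below half of that. *)
pose e := Num.min ((r - rT) / 2) (Num.min (dl * (1 - r) / 4) (dl / 4 / K)).
have e0 : 0 < e.
  rewrite !lt_min !divr_gt0 ?mulr_gt0 //; first by rewrite subr_gt0.
have e1 : e <= (r - rT) / 2 by rewrite ge_min lexx.
have e2 : e <= dl * (1 - r) / 4 by rewrite !ge_min lexx orbT.
have e3 : e <= dl / 4 / K by rewrite !ge_min lexx !orbT.
have e4 : 2 * e / (1 - r) <= dl / 2 by clear Tdl; rewrite ler_pdivrMr //; lra.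
have e5 : rT + e < r by clear Tdl; lra.
have e6 : K * e <= dl / 2 / 2.
  by clear Tdl; move: e3; rewrite ler_pdivlMr // mulrC; lra.
apply/nbhs_ballP; exists e => //= S TS.
have bS := cocycle_blaschke S; have bT := cocycle_blaschke T.
have /cocycle_dist_ae TSe : (cocycle_dist P T S <= e%:E)%E by exact: ltW TS.
have Sr : (cocycle_radius P S rho < r%:E)%E.
  by apply: le_lt_trans (cocycle_radius_close Trho TSe) _; rewrite lte_fin.
have dl2 : 0 < dl / 2 by exact: divr_gt0.
apply: (stab S x e (dl / 2) Sr (borel_fun_almost_discrete bx) xr (ltW e0) _ dl2 _ e6).
- apply: filterS2 Tx TSe => w <- TSe; rewrite cabsB; apply: TSe.
  exact: le_trans (xr w) (ltW r1).
- apply: filterS2 Tdl TSe => w Tdl TSe.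
  have [n [_ bn]] := blaschke_cocycle_is_blaschke w bT.
  have [m [_ bm]] := blaschke_cocycle_is_blaschke w bS.
  have h := blaschke_derive1_dist r1 bn bm (xr w) TSe.
  exact: half_bound Tdl (cabsB_ge _ _) (le_trans h e4).
Qed.

(* T and its fixed point x are constant up to eta on the fibers of a countable
   partition, so one perturbation per fiber is enough: measurability is free. *)
Lemma dense_stable : dense stable.
Proof.
move=> O [T OT] oO.
have /nbhs_ballP[e0 /= e00 TO] := open_nbhs_nbhs (conj oO OT).
have bT := cocycle_blaschke T.
have [rT [rTE rT0 rTrho Trho]] := cocycle_radius_real rho0 (cocycle_radius_lt T).
pose r := (rT + rho) / 2.
have rTr : rT < r by rewrite /r; lra.
have rr : r < rho by rewrite /r; lra.
have r0 : 0 < r by exact: le_lt_trans rTr.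
have r1 : r < 1 by exact: lt_trans rho1.
have r1' : 0 < 1 - r by rewrite subr_gt0.
have Tr : (cocycle_radius P T rho < r%:E)%E by rewrite rTE lte_fin.
have [x [[bx _ Tx] xr]] := random_fixed_point_exists msigma mtau st ts Psigma
  rho0 rho1 r0 rr bT Tr.
(* The total displacement is at most [2 * eps]: one [eps] for the perturbation, one for replacing T
   by its representative on the cell. *)
pose eps := Num.min (e0 / 4) ((r - rT) / 4).
have eps0 : 0 < eps by rewrite lt_min !divr_gt0 // subr_gt0.
have eps1 : 2 * eps < e0.
  by have : eps <= e0 / 4 by [rewrite ge_min lexx]; move: e00; lra.
have eps2 : rT + 2 * eps < r.
  by have : eps <= (r - rT) / 4 by [rewrite ge_min lexx orbT]; move: rTr; lra.
have [dl dl0 pert] := blaschke_perturbation (ltW r0) r1 eps0.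
have [K K0 stab] := stable_of_near_fixed_point r0 rr.
pose L := 2 / (1 - r); have L0 : 0 < L by exact: divr_gt0.
pose L' := 8 / (1 - r) ^+ 2.
have L'0 : 0 < L' by apply: divr_gt0 => //; exact: exprn_gt0.
(* From g(x) to $T_w(x)$ through $g(x_0)=T_{w_0}(x_0)$: a Lipschitz step for g, one for $T_{w_0}$,
   and the distance from $T_{w_0}$ to $T_w$. *)
pose c := 2 * L + 1; have c0 : 0 < c by rewrite /c; move: L0; lra.
pose eta := Num.min eps (Num.min (dl / 2 / L') (dl / 4 / (K * c))).
have eta0 : 0 < eta.
  by rewrite lt_min eps0 lt_min /=; apply/andP; split;
     apply: divr_gt0; rewrite ?divr_gt0 // mulr_gt0.
have eta1 : eta <= eps by rewrite ge_min lexx.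
have eta2 : L' * eta <= dl / 2.
  by rewrite mulrC -ler_pdivlMr // !ge_min lexx orbT.
have eta3 : K * (c * eta) <= dl / 2 / 2.
  have : eta <= dl / 4 / (K * c) by rewrite !ge_min lexx !orbT.
  by rewrite ler_pdivlMr ?mulr_gt0 //; lra.
have [k [mk kTx]] := constant_on_fibers_and
  (blaschke_cocycle_almost_discrete bT eta0)
  (borel_fun_almost_discrete bx eta0).
have x1 w : cabs (x w) <= 1 by exact: le_trans (xr w) (ltW r1).
pose good (S : C -> C) w :=
  [/\ forall z, cabs z <= 1 -> cabs (S z - T w z) <= 2 * eps,
      cabs (S (x w) - T w (x w)) <= c * eta &
      dl / 2 <= cabs (derive1 S (x w))].
have /choice[p pP] (i : nat) : exists p : nat * C * (nat -> C),
    [/\ (1 <= p.1.1)%N, cabs p.1.2 = 1, forall j, (j < p.1.1)%N -> cabs (p.2 j) < 1 &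
      forall w, k w = i -> cabs (T w (x w)) <= r ->
        good (blaschke p.1.1 p.1.2 p.2) w].
  (* The perturbation needs $|T_{w_0}(x_{w_0})|\le r$, which holds almost everywhere because this
     value is $x_{\sigma w_0}$. Cells without such a point receive the Blaschke product z. *)
  have [[w0 [kw0 Tw0]]|none] := pselect (exists w, k w = i /\ cabs (T w (x w)) <= r);
    last first.
    exists (1%N, 1, fun=> 0); split=> //= [|j _|w kw Tw]; rewrite ?cabs1 ?cabs0 //.
    by exfalso; apply: none; exists w.
  have [n [n1 bn]] := blaschke_cocycle_is_blaschke w0 bT.
  have [g [bg gx dg gT]] := pert n (T w0) (x w0) bn (xr w0) Tw0.
  have [zeta [a [zeta1 a1 gE]]] := bg.
  exists (n, zeta, a); split; [exact: n1|exact: zeta1|exact: a1|move=> w kw Tw].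
  suff : good g w by rewrite gE => h; exact: h.
  have [TT xx] : (forall z, cabs z <= 1 -> cabs (T w z - T w0 z) <= eta) /\
      cabs (x w - x w0) <= eta by apply: kTx; rewrite kw kw0.
  split.
  - move=> z z1; apply: le_trans (cabs_dist_triangle _ (T w0 z) _) _.
    rewrite mulr_natl mulr2n lerD ?gT // cabsB.
    exact: le_trans (TT z z1) eta1.
  - have Lx n' f : is_blaschke n' f -> cabs (f (x w) - f (x w0)) <= L * eta.
      move=> bf; apply: le_trans (blaschke_lipschitz r1 bf (xr w0) (x1 w)) _.
      by rewrite -/L; apply: (ler_wpM2l (ltW L0)).
    have h1 := Lx _ _ bg; have h2 := Lx _ _ bn; have h3 := TT _ (x1 w).
    apply: le_trans (cabs_dist_triangle _ (g (x w0)) _) _.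
    rewrite [leRHS](_ : _ = L * eta + (L * eta + eta)); last by rewrite /c; ring.
    apply: lerD h1 _; rewrite gx.
    apply: le_trans (cabs_dist_triangle _ (T w0 (x w)) _) _.
    by apply: lerD; rewrite cabsB.
  - have h := blaschke_derive1_lipschitz r1 bg (xr w) (xr w0).
    rewrite cabsB in xx.
    have h' := le_trans (ler_wpM2l (ltW L'0) xx) eta2.
    exact: half_bound dg (cabsB_ge _ _) (le_trans h h').
pose S w := blaschke (p (k w)).1.1 (p (k w)).1.2 (p (k w)).2.
have bS : blaschke_cocycle S.
  exists (fun w => (p (k w)).1.1), (fun w => (p (k w)).1.2), (fun j w => (p (k w)).2 j).
  have mn : measurable_fun [set: Omega] (fun w => (p (k w)).1.1).
    move=> _ Y _; rewrite setTI.
    exact: (measurable_fibers_preimage ((fun i => (p i).1.1) @^-1` Y) mk).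
  split=> // [|j|w].
  - exact: (borel_fun_fibers (fun i => (p i).1.2) measurableT mk).
  - apply: (borel_fun_fibers (fun i => (p i).2 j) _ mk).
    by rewrite -[X in measurable X]setTI; exact: (mn measurableT [set m | (j < m)%N]).
  - by have [] := pP (k w).
have goodS : {ae P, forall w, good (S w) w}.
  apply: filterS Tx => w Tx; have [_ _ _ gp] := pP (k w).
  by apply: gp (erefl _) _; rewrite Tx.
have TS : {ae P, forall w, forall z, cabs z <= 1 -> cabs (T w z - S w z) <= 2 * eps}.
  by apply: filterS goodS => w [h _ _] z z1; rewrite cabsB h.
have Sr : (cocycle_radius P S rho < r%:E)%E.
  by apply: le_lt_trans (cocycle_radius_close Trho TS) _; rewrite lte_fin.
have Srho : (cocycle_radius P S rho < rho%:E)%E.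
  by apply: lt_trans Sr _; rewrite lte_fin.
exists (BlaschkeSpace bS Srho); split.
  apply: TO; rewrite /ball /= /blaschke_ball /=.
  by apply: (@le_lt_trans _ _ (2 * eps)%:E); [exact/cocycle_dist_ae|rewrite lte_fin].
have ce0 : 0 <= c * eta by exact: mulr_ge0 (ltW c0) (ltW eta0).
have dl2 : 0 < dl / 2 by exact: divr_gt0.
have Sx : {ae P, forall w, cabs (S w (x w) - x (sigma w)) <= c * eta}.
  by apply: filterS2 Tx goodS => w <- [].
have Sdl : {ae P, forall w, dl / 2 <= cabs (derive1 (S w) (x w))}.
  by apply: filterS goodS => w [_ _ h]; exact: h.
exact: (stab (BlaschkeSpace bS Srho) x (c * eta) (dl / 2) Sr
  (borel_fun_almost_discrete bx) xr ce0 Sx dl2 Sdl eta3).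
Qed.

End stable_cocycles.

Theorem corollary6 (R : realType) (d : measure_display)
    (Omega : measurableType d) (P : probability Omega R)
    (sigma : Omega -> Omega) (rho : R) :
  measurably_invertible sigma ->
  measure_preserving P sigma ->
  ergodic P sigma ->
  0 < rho -> rho < 1 ->
  open (@stable R d Omega P sigma rho) /\
  dense (@stable R d Omega P sigma rho).
Proof.
move=> [tau [msigma mtau st ts]] Psigma _ rho0 rho1.
by split; [exact: open_stable ts _ _ _|exact: dense_stable ts _ _ _].
Qed.
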